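(* Let $f\colon[0,1]\to[0,1]$ be a piecewise monotone, finite-to-one, computable function all of whose local extrema are effectively asymptotically periodic, and let $K=\{x\in[0,1]^\omega:\ f(x(n+1))=x(n)\text{ for all }n\}$ be the inverse limit of arcs with bonding map $f$. Then every point of $K$ is $tt$-equivalent to a point of $\mathbb{R}\times 2^\omega$, i.e., $\mathcal{D}_{tt}(K)\subseteq\mathcal{D}_{tt}(\mathbb{R}\times 2^\omega)$.
   Context: Local extrema of $f$ are the local extremum points of $f$ other than the endpoints $0,1$. A point $x\in[0,1]$ is effectively asymptotically periodic if the closure $\overline{O}$ of its forward orbit $O=\{f^k(x):k\in\omega\}$ is a $\Pi^0_1$ subset of $[0,1]$ and $\overline{O}$ is the union of $O$ and a finite (periodic) orbit. $K$ is regarded as a computable metric subspace of $[0,1]^\omega$. For points $x,y$ of computable Polish spaces, $y\le_{tt}x$ iff there is a partial computable function (realized on Cauchy names) with $\Pi^0_1$ domain (complement of a union of a computable sequence of rational balls) containing $x$ and sending $x$ to $y$; $\equiv_{tt}$ is mutual $\le_{tt}$, and $\mathcal{D}_{tt}(\mathcal{X})$ is the set of $\equiv_{tt}$-classes of points of $\mathcal{X}$. *)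

(* Defs.v *)
From HB Require Import structures.
From Stdlib Require Cantor.
From mathcomp Require Import all_boot all_order all_algebra.
From mathcomp Require Import all_classical all_reals all_analysis.

Set Implicit Arguments.
Unset Strict Implicit.
Unset Printing Implicit Defensive.

Import Order.TTheory GRing.Theory Num.Theory.
Import numFieldNormedType.Exports.

Local Open Scope classical_set_scope.
Local Open Scope ring_scope.

(* Partial recursive functionals with an oracle in Baire space.  Functions are
   unary; several arguments are coded by the Cantor pairing. *)

Definition cpair (a b : nat) : nat := Cantor.to_nat (a, b).
Definition cfst (n : nat) : nat := (Cantor.of_nat n).1.
Definition csnd (n : nat) : nat := (Cantor.of_nat n).2.

Inductive prog : Type :=
| CZero | CSucc | CFst | CSnd | COracle
| CPair of prog & prog
| CComp of prog & prog
| CPrec of prog & prog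
| CMu of prog.

(* [run p c n m]: the program [c] with oracle [p] halts on input [n] with
   output [m].  [CComp c d] is c after d, and [CMu c] is unbounded search for
   the least zero. *)
Inductive run (p : nat -> nat) : prog -> nat -> nat -> Prop :=
| run_zero n : run p CZero n 0%N
| run_succ n : run p CSucc n n.+1
| run_fst n : run p CFst n (cfst n)
| run_snd n : run p CSnd n (csnd n)
| run_oracle n : run p COracle n (p n)
| run_pair c d n a b :
    run p c n a -> run p d n b -> run p (CPair c d) n (cpair a b)
| run_comp c d n a b :
    run p d n a -> run p c a b -> run p (CComp c d) n b
| run_prec0 c d a b :
    run p c a b -> run p (CPrec c d) (cpair a 0%N) b
| run_precS c d a n r b :
    run p (CPrec c d) (cpair a n) r ->
    run p d (cpair a (cpair n r)) b ->
    run p (CPrec c d) (cpair a n.+1) b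
| run_mu c a n (h : nat -> nat) :
    run p c (cpair a n) 0%N ->
    (forall k, (k < n)%N -> run p c (cpair a k) (h k).+1) ->
    run p (CMu c) a n.

Definition computable_seq (u : nat -> nat) : Prop :=
  exists c, forall n, run (fun=> 0%N) c n (u n).

(* The data of a metric space with a numbering of ideal (rational) points,
   together with a subset [carrier]: the points of the space are those of
   [carrier], but the ideal points need not lie in it.  This is how a subspace
   of a computable metric space inherits its Cauchy names and rational balls.
   The metric axioms are not part of the record; they hold for the concrete
   spaces below, on the Hilbert cube only inside its carrier. *)
Record metric_space (R : realType) := MetricSpace {
  ambient :> Type;
  sdist : ambient -> ambient -> R;
  ideal : nat -> ambient;
  carrier : set ambient
}.
Arguments sdist {R} m _ _.
Arguments ideal {R} m _.
Arguments carrier {R} m _.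

Section EffectiveSpaces.
Variable R : realType.
Implicit Types X Y : metric_space R.

Definition cauchy_name X (x : X) (p : nat -> nat) : Prop :=
  forall n, sdist X x (ideal X (p n)) <= 2^-1 ^+ n.

(* The radius may be 0, so that a computable sequence of rational balls may
   have empty union. *)
Definition rational_ball X (n : nat) : set X :=
  let r := (cfst (csnd n))%:R / (csnd (csnd n)).+1%:R in
  [set x | sdist X (ideal X (cfst n)) x < r].

Definition pi01 X (A : set X) : Prop :=
  exists2 u, computable_seq u &
    A = carrier X `\` \bigcup_n rational_ball (u n).

(* [c] realizes on Cauchy names the partial function from X to Y that is the
   restriction of F to D; the values of F outside D are irrelevant. *)
Definition realizes X Y (c : prog) (D : set X) (F : X -> Y) : Prop :=
  forall x, D x -> carrier Y (F x) /\
    forall p, cauchy_name x p ->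
      exists2 q, (forall n, run p c n (q n)) & cauchy_name (F x) q.

Definition computable_on X Y (D : set X) (F : X -> Y) : Prop :=
  exists c, realizes c D F.

Definition tt_le Y (y : Y) X (x : X) : Prop :=
  exists (D : set X) (F : X -> Y),
    [/\ pi01 D, computable_on D F, D x & F x = y].

Definition tt_equiv X (x : X) Y (y : Y) : Prop :=
  @tt_le X x Y y /\ @tt_le Y y X x.

Definition metric_subspace X (A : set X) : metric_space R :=
  MetricSpace (sdist X) (ideal X) (carrier X `&` A).

Definition ratn (n : nat) : R :=
  ((cfst n)%:R - (cfst (csnd n))%:R) / (csnd (csnd n)).+1%:R.

Definition real_line : metric_space R :=
  MetricSpace (fun x y : R => `|x - y|) ratn setT.

Definition unit_interval : metric_space R :=
  MetricSpace (fun x y : R => `|x - y|)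
    (fun n => Num.max 0 (Num.min 1 (ratn n))) `[0, 1].

Definition bool_space : metric_space R :=
  MetricSpace (fun b c : bool => (b != c)%:R) odd setT.

Definition prod_space X Y : metric_space R :=
  MetricSpace (fun z w : X * Y => Num.max (sdist X z.1 w.1) (sdist Y z.2 w.2))
    (fun n => (ideal X (cfst n), ideal Y (csnd n)))
    (carrier X `*` carrier Y).

(* The i-th entry of the eventually zero sequence coded by n: since
   [csnd n < n] for n > 0 and [cpair 0 0 = 0], every n codes such a sequence
   and every such sequence has exactly one code. *)
Definition entry (n i : nat) : nat := cfst (iter i csnd n).

(* Countable power of a space of diameter at most 1; the ideal points are the
   sequences of ideal points that are eventually equal to [ideal X 0]. *)
Definition omega_power X : metric_space R :=
  MetricSpace (fun x y : nat -> X =>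
      sup (range (fun n : nat => 2^-1 ^+ n * sdist X (x n) (y n))))
    (fun n i => ideal X (entry n i))
    [set x | forall n, carrier X (x n)].

Definition hilbert_cube : metric_space R := omega_power unit_interval.
Definition cantor_space : metric_space R := omega_power bool_space.
Definition real_cantor : metric_space R := prod_space real_line cantor_space.

(* In what follows, f : R -> R stands for its restriction to [0, 1]. *)

Definition piecewise_monotone (f : R -> R) : Prop :=
  exists2 s : seq R, itv_partition 0 1 s &
    forall i, (i < size s)%N ->
      let J := `[nth 0 (0 :: s) i, nth 0 s i] in
      {in J &, {homo f : x y / x <= y}} \/ {in J &, {homo f : x y /~ x <= y}}.

Definition finite_to_one (f : R -> R) : Prop :=
  forall y, finite_set (`[0, 1] `&` f @^-1` [set y]).

Definition local_extremum (f : R -> R) (x : R) : Prop :=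
  0 < x < 1 /\
  ((\forall z \near x, f z <= f x) \/ (\forall z \near x, f x <= f z)).

Definition forward_orbit (f : R -> R) (x : R) : set R :=
  range (fun k => iter k f x).

Definition periodic_point (f : R -> R) (x : R) : Prop :=
  exists2 k, (0 < k)%N & iter k f x = x.

(* The closure is taken in R; for orbits in [0, 1] it is also the closure
   in [0, 1]. *)
Definition eff_asymptotically_periodic (f : R -> R) (x : R) : Prop :=
  let O := forward_orbit f x in
  @pi01 unit_interval (closure O) /\
  exists z, [/\ 0 <= z <= 1, periodic_point f z &
    closure O = O `|` forward_orbit f z].

Definition inverse_limit (f : R -> R) : metric_space R :=
  @metric_subspace hilbert_cube [set x | forall n, f (x n.+1) = x n].

End EffectiveSpaces.

Arguments real_cantor {R}.
Arguments unit_interval {R}.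
Arguments cauchy_name {R} X x p.
Arguments rational_ball {R} X n _.
Arguments pi01 {R} X A.
Arguments computable_on {R} X Y D F.
Arguments tt_le {R} Y y X x.
Arguments tt_equiv {R} X x Y y.

(* Main.v *)
(* A point z of K is coded by its address: the coordinate z_N together with the
   bits "z_{N+1+n} < r_i", for a computable sequence of reals r_i.  If D is a
   Pi^0_1 subset of K on which no z_{N+1+n} equals an r_i and on which the address
   is injective, then the address is computable on D, and, K being effectively
   compact, so is its inverse, whose domain is again Pi^0_1: expand the coordinates
   in binary and discard the finite bit strings that are seen not to begin a point
   of D with the given address; only the right ones survive in the end.
   For x in K there are two cases.  If all x_n lie in the orbit closure A of one
   local extremum, take D = {z : all z_n in A} and for the r_i the rationals in the
   complement of A; they separate the points of A because A is countable.
   Otherwise, orbit closures being forward invariant, some x_N lies outside the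
   orbit closures of all local extrema; let D demand that z_N stays in a rational
   interval around x_N avoiding their orbits, so that no later coordinate is an
   extremum, and take for the r_i the extrema, which are computable because f is
   unimodal near them.  Then z_n and the bits determine z_{n+1}, since f is
   injective between consecutive extrema. *)

From Stdlib Require Cantor.
From mathcomp Require Import all_boot all_order all_algebra.
From mathcomp Require Import all_classical all_reals all_analysis.
From mathcomp Require Import zify ring lra.
Require Import Defs.

Set Implicit Arguments.
Unset Strict Implicit.
Unset Printing Implicit Defensive.

Import Order.TTheory GRing.Theory Num.Theory.
Import numFieldNormedType.Exports.

Local Open Scope classical_set_scope.
Local Open Scope ring_scope.

(** * Total computable functionals and evaluation on finite oracles *)

Lemma cfstK a b : cfst (cpair a b) = a.
Proof. by rewrite /cfst /cpair Cantor.cancel_of_to. Qed.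

Lemma csndK a b : csnd (cpair a b) = b.
Proof. by rewrite /csnd /cpair Cantor.cancel_of_to. Qed.

Lemma cpairK n : cpair (cfst n) (csnd n) = n.
Proof.
rewrite /cfst /csnd /cpair -[RHS]Cantor.cancel_to_of.
by case: (Cantor.of_nat n).
Qed.

Lemma leq_cpair a b a' b' :
  (a <= a')%N -> (b <= b')%N -> (cpair a b <= cpair a' b')%N.
Proof.
move=> ha hb; rewrite /cpair.
have := Cantor.to_nat_spec a b; have := Cantor.to_nat_spec a' b'.
have h : ((b + a) * (b + a).+1 <= (b' + a') * (b' + a').+1)%N.
  by apply: leq_mul; rewrite ?ltnS leq_add.
move: h; set u := ((b + a) * _)%N; set v := ((b' + a') * _)%N.
rewrite /u /v; lia.
Qed.

(** Totality on every oracle lets these functionals be composed freely; partial programs are built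
    only by [cfun_mu]. *)
Definition cfun (F : (nat -> nat) -> nat -> nat) : Prop :=
  exists c, forall p n, run p c n (F p n).

Lemma cfun_ext F G : (forall p n, F p n = G p n) -> cfun F -> cfun G.
Proof. by move=> FG [c cF]; exists c => p n; rewrite -FG. Qed.

Lemma cf_id : cfun (fun _ n => n).
Proof.
exists (CPair CFst CSnd) => p n; rewrite -[X in run _ _ _ X]cpairK.
by apply: run_pair; constructor.
Qed.

Lemma cf_comp G F : cfun G -> cfun F -> cfun (fun p n => G p (F p n)).
Proof. by move=> [c cG] [d dF]; exists (CComp c d) => p n; exact: run_comp. Qed.

Lemma cf_pair F G : cfun F -> cfun G -> cfun (fun p n => cpair (F p n) (G p n)).
Proof. by move=> [c cF] [d dG]; exists (CPair c d) => p n; exact: run_pair. Qed.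

Lemma cf_succ F : cfun F -> cfun (fun p n => (F p n).+1).
Proof. by apply: (@cf_comp (fun _ n => n.+1)); exists CSucc; constructor. Qed.

Lemma cf_fst F : cfun F -> cfun (fun p n => cfst (F p n)).
Proof. by apply: (@cf_comp (fun _ n => cfst n)); exists CFst; constructor. Qed.

Lemma cf_snd F : cfun F -> cfun (fun p n => csnd (F p n)).
Proof. by apply: (@cf_comp (fun _ n => csnd n)); exists CSnd; constructor. Qed.

Lemma cf_oracle F : cfun F -> cfun (fun p n => p (F p n)).
Proof. by apply: (@cf_comp (fun p n => p n)); exists COracle; constructor. Qed.

Lemma cf_const m : cfun (fun _ _ => m).
Proof.
elim: m => [|m IH]; first by exists CZero; constructor.
exact: (cf_succ IH).
Qed.

Lemma cf_rec A K S : cfun A -> cfun K ->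
  cfun (fun p m => S p (cfst m) (cfst (csnd m)) (csnd (csnd m))) ->
  cfun (fun p n => iteri (K p n) (S p n) (A p n)).
Proof.
move=> [a aA] [k kK] [s sS]; have [i iI] := cf_id.
exists (CComp (CPrec a s) (CPair i k)) => p n.
apply: run_comp; first exact: run_pair.
elim: (K p n) => [|j IH] /=; first exact: run_prec0.
apply: (run_precS IH).
by have := sS p (cpair n (cpair j (iteri j (S p n) (A p n)))); rewrite !(cfstK, csndK).
Qed.

Definition cfun2 (O : (nat -> nat) -> nat -> nat -> nat) : Prop :=
  cfun (fun p m => O p (cfst m) (csnd m)).

Lemma cf2 O A B : cfun2 O -> cfun A -> cfun B -> cfun (fun p n => O p (A p n) (B p n)).
Proof.
move=> cO cA cB; have := cf_comp cO (cf_pair cA cB).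
by apply: cfun_ext => p n; rewrite !(cfstK, csndK).
Qed.

Lemma cf_pred F : cfun F -> cfun (fun p n => (F p n).-1).
Proof.
move=> cF; have := @cf_rec (fun _ _ => 0%N) F (fun _ _ k _ => k) (cf_const 0) cF _.
move=> /(_ (cf_fst (cf_snd cf_id))); apply: cfun_ext => p n.
by case: (F p n).
Qed.

Lemma cf_add F G : cfun F -> cfun G -> cfun (fun p n => (F p n + G p n)%N).
Proof.
move=> cF cG; have := @cf_rec F G (fun _ _ _ r => r.+1) cF cG _.
move=> /(_ (cf_succ (cf_snd (cf_snd cf_id)))); apply: cfun_ext => p n.
by elim: (G p n) => [|k IH] /=; rewrite ?addn0 ?addnS ?IH.
Qed.

Lemma cf_sub F G : cfun F -> cfun G -> cfun (fun p n => (F p n - G p n)%N).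
Proof.
move=> cF cG; have := @cf_rec F G (fun _ _ _ r => r.-1) cF cG _.
move=> /(_ (cf_pred (cf_snd (cf_snd cf_id)))); apply: cfun_ext => p n.
by elim: (G p n) => [|k IH] /=; rewrite ?subn0 ?subnS ?IH.
Qed.

Lemma cf_mul F G : cfun F -> cfun G -> cfun (fun p n => (F p n * G p n)%N).
Proof.
move=> cF cG; have := @cf_rec (fun _ _ => 0%N) G (fun p n _ r => r + F p n)%N (cf_const 0) cG _.
move=> /(_ (cf_add (cf_snd (cf_snd cf_id)) (cf_comp cF (cf_fst cf_id)))).
apply: cfun_ext => p n.
by elim: (G p n) => [|k IH] /=; rewrite ?muln0 // mulnS IH addnC.
Qed.

Lemma cf_exp2 F : cfun F -> cfun (fun p n => (2 ^ F p n)%N).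
Proof.
move=> cF; have := @cf_rec (fun _ _ => 1%N) F (fun _ _ _ r => r + r)%N (cf_const 1) cF _.
move=> /(_ (cf_add (cf_snd (cf_snd cf_id)) (cf_snd (cf_snd cf_id)))).
apply: cfun_ext => p n.
by elim: (F p n) => [|k IH] //=; rewrite IH expnS mul2n addnn.
Qed.

Lemma cf_leq F G : cfun F -> cfun G -> cfun (fun p n => nat_of_bool (F p n <= G p n)%N).
Proof.
move=> cF cG; apply: (cfun_ext _ (cf_sub (cf_const 1) (cf_sub cF cG))) => p n.
by rewrite /leq; case: (F p n - G p n)%N => //= k; rewrite subSS sub0n.
Qed.

Lemma cf_and (A B : (nat -> nat) -> nat -> bool) :
  cfun (fun p n => nat_of_bool (A p n)) -> cfun (fun p n => nat_of_bool (B p n)) ->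
  cfun (fun p n => nat_of_bool (A p n && B p n)).
Proof.
move=> cA cB; apply: (cfun_ext _ (cf_mul cA cB)) => p n.
by case: (A p n); case: (B p n).
Qed.

Lemma cf_neg (A : (nat -> nat) -> nat -> bool) :
  cfun (fun p n => nat_of_bool (A p n)) -> cfun (fun p n => nat_of_bool (~~ A p n)).
Proof.
by move=> cA; apply: (cfun_ext _ (cf_sub (cf_const 1) cA)) => p n; case: (A p n).
Qed.

Lemma cf_or (A B : (nat -> nat) -> nat -> bool) :
  cfun (fun p n => nat_of_bool (A p n)) -> cfun (fun p n => nat_of_bool (B p n)) ->
  cfun (fun p n => nat_of_bool (A p n || B p n)).
Proof.
move=> cA cB; apply: (cfun_ext _ (cf_neg (cf_and (cf_neg cA) (cf_neg cB)))) => p n.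
by case: (A p n); case: (B p n).
Qed.

Lemma cf_eqn F G : cfun F -> cfun G -> cfun (fun p n => nat_of_bool (F p n == G p n)).
Proof.
move=> cF cG; apply: (cfun_ext _ (cf_and (cf_leq cF cG) (cf_leq cG cF))) => p n.
by rewrite -eqn_leq.
Qed.

Lemma cf_if (A : (nat -> nat) -> nat -> bool) F G :
  cfun (fun p n => nat_of_bool (A p n)) -> cfun F -> cfun G ->
  cfun (fun p n => if A p n then F p n else G p n).
Proof.
move=> cA cF cG.
apply: (cfun_ext _ (cf_add (cf_mul cA cF) (cf_mul (cf_neg cA) cG))) => p n.
by case: (A p n); rewrite /= ?mul1n ?mul0n ?addn0.
Qed.

Lemma cf_half F : cfun F -> cfun (fun p n => (F p n)./2).
Proof.
(* The recursion is [k.+1./2 = k - k./2]. *)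
move=> cF; have := @cf_rec (fun _ _ => 0%N) F (fun _ _ k r => k - r)%N (cf_const 0) cF _.
move=> /(_ (cf_sub (cf_fst (cf_snd cf_id)) (cf_snd (cf_snd cf_id)))).
apply: cfun_ext => p n; elim: (F p n) => [|k IH] //=.
rewrite IH uphalf_half; have := odd_double_half k; lia.
Qed.

Lemma cf_odd F : cfun F -> cfun (fun p n => nat_of_bool (odd (F p n))).
Proof.
move=> cF.
apply: (cfun_ext _ (cf_sub cF (cf_mul (cf_const 2) (cf_half cF)))) => p n.
by rewrite -[X in (X - _)%N]odd_double_half -mul2n addnK.
Qed.

Definition all_lt (m : nat) (P : nat -> bool) : bool := all P (iota 0 m).
Definition has_lt (m : nat) (P : nat -> bool) : bool := has P (iota 0 m).

Lemma all_ltP m (P : nat -> bool) : reflect (forall k, (k < m)%N -> P k) (all_lt m P).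
Proof.
apply: (iffP allP) => h k; first by move=> km; apply: h; rewrite mem_iota.
by rewrite mem_iota => /andP[_ km]; exact: h.
Qed.

Lemma has_ltP m (P : nat -> bool) : reflect (exists2 k, (k < m)%N & P k) (has_lt m P).
Proof.
apply: (iffP hasP) => -[k km Pk]; exists k => //; first by move: km; rewrite mem_iota.
by rewrite mem_iota.
Qed.

Lemma cf_all K (P : (nat -> nat) -> nat -> nat -> bool) : cfun K ->
  cfun (fun p m => nat_of_bool (P p (cfst m) (csnd m))) ->
  cfun (fun p n => nat_of_bool (all_lt (K p n) (P p n))).
Proof.
move=> cK cP.
have := @cf_rec (fun _ _ => 1%N) K (fun p n k r => r * nat_of_bool (P p n k))%N
  (cf_const 1) cK _.
move=> /(_ (cf_mul (cf_snd (cf_snd cf_id)) (@cf2 (fun p n k => nat_of_bool (P p n k)) _ _ cP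
  (cf_fst cf_id) (cf_fst (cf_snd cf_id))))).
apply: cfun_ext => p n; elim: (K p n) => [|k IH] //=.
by rewrite IH /all_lt -addn1 iotaD all_cat /= andbT add0n; case: all; case: (P p n k).
Qed.

Lemma cf_has K (P : (nat -> nat) -> nat -> nat -> bool) : cfun K ->
  cfun (fun p m => nat_of_bool (P p (cfst m) (csnd m))) ->
  cfun (fun p n => nat_of_bool (has_lt (K p n) (P p n))).
Proof.
move=> cK cP; have := cf_neg (@cf_all K (fun p n k => ~~ P p n k) cK (cf_neg cP)).
apply: cfun_ext => p n; congr nat_of_bool.
by rewrite /all_lt /has_lt -has_predC; apply: eq_has => k /=; rewrite negbK.
Qed.

Lemma cf_entry F G : cfun F -> cfun G -> cfun (fun p n => entry (F p n) (G p n)).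
Proof.
move=> cF cG; apply: cf_fst.
have := @cf_rec F G (fun _ _ _ r => csnd r) cF cG (cf_snd (cf_snd (cf_snd cf_id))).
by apply: cfun_ext => p n; elim: (G p n) => //= k ->.
Qed.

Definition bit (s j : nat) : bool := odd (iter j half s).

Lemma cf_bit F G : cfun F -> cfun G -> cfun (fun p n => nat_of_bool (bit (F p n) (G p n))).
Proof.
move=> cF cG; apply: cf_odd.
have := @cf_rec F G (fun _ _ _ r => r./2) cF cG (cf_half (cf_snd (cf_snd cf_id))).
by apply: cfun_ext => p n; elim: (G p n) => //= k ->.
Qed.

(** Extension point of [cf], redefined once the interpreter and rational arithmetic are
    available. *)
Ltac cf_more := fail.

Ltac cf_step :=
  cbn beta;
  first [ exact: cf_id | exact: cf_const | assumption
  | lazymatch goal with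
    | |- cfun (fun p n => cfst (@?F p n)) => apply: (@cf_fst F)
    | |- cfun (fun p n => csnd (@?F p n)) => apply: (@cf_snd F)
    | |- cfun (fun p n => cpair (@?F p n) (@?G p n)) => apply: (@cf_pair F G)
    | |- cfun (fun p n => entry (@?F p n) (@?G p n)) => apply: (@cf_entry F G)
    | |- cfun (fun p n => S (@?F p n)) => apply: (@cf_succ F)
    | |- cfun (fun p n => predn (@?F p n)) => apply: (@cf_pred F)
    | |- cfun (fun p n => addn (@?F p n) (@?G p n)) => apply: (@cf_add F G)
    | |- cfun (fun p n => subn (@?F p n) (@?G p n)) => apply: (@cf_sub F G)
    | |- cfun (fun p n => muln (@?F p n) (@?G p n)) => apply: (@cf_mul F G)
    | |- cfun (fun p n => expn 2 (@?F p n)) => apply: (@cf_exp2 F)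
    | |- cfun (fun p n => if _ then _ else _) => apply: cf_if
    | |- cfun (fun p n => nat_of_bool (andb (@?F p n) (@?G p n))) => apply: (@cf_and F G)
    | |- cfun (fun p n => nat_of_bool (orb (@?F p n) (@?G p n))) => apply: (@cf_or F G)
    | |- cfun (fun p n => nat_of_bool (negb (@?F p n))) => apply: (@cf_neg F)
    | |- cfun (fun p n => nat_of_bool (leq (@?F p n) (@?G p n))) => apply: (@cf_leq F G)
    | |- cfun (fun p n => nat_of_bool (@eq_op _ (@?F p n) (@?G p n))) => apply: (@cf_eqn F G)
    | |- cfun (fun p n => nat_of_bool (odd (@?F p n))) => apply: (@cf_odd F)
    | |- cfun (fun p n => nat_of_bool (bit (@?F p n) (@?G p n))) => apply: (@cf_bit F G)
    | |- cfun (fun p n => nat_of_bool (all_lt (@?F p n) (@?G p n))) => apply: (@cf_all F G)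
    | |- cfun (fun p n => nat_of_bool (has_lt (@?F p n) (@?G p n))) => apply: (@cf_has F G)
    | |- cfun (fun p n => iteri (@?F p n) (@?H p n) (@?G p n)) => apply: (@cf_rec G F H)
    end
  | cf_more
  | lazymatch goal with
    | |- cfun (fun p n => p (@?F p n)) => apply: (@cf_oracle F)
    | h : cfun2 ?O |- cfun (fun p n => ?O p (@?F p n) (@?G p n)) => apply: (@cf2 O F G h)
    end ].
Ltac cf := repeat cf_step.

(** Unbounded search for a witness [T] of a decidable test, followed by a total post-processing [H].
    The program is fixed before the oracle, so it serves every oracle for which witnesses exist. *)
Lemma cfun_mu (P : (nat -> nat) -> nat -> nat -> bool) (H : (nat -> nat) -> nat -> nat -> nat) :
  cfun (fun p m => nat_of_bool (P p (cfst m) (csnd m))) -> cfun2 H ->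
  exists c, forall p, (forall n, exists T, P p n T) ->
    exists2 q, forall n, run p c n (q n) & forall n, exists2 T, P p n T & q n = H p n T.
Proof.
move=> cP [h hH]; have [i iI] := cf_id; have [c cP'] := cf_neg cP.
exists (CComp h (CPair i (CMu c))) => p ex.
exists (fun n => H p n (ex_minn (ex n))) => n; case: ex_minnP => T PT minT; last by exists T.
apply: (@run_comp _ _ _ _ (cpair n T)); last first.
  by have := hH p (cpair n T); rewrite !(cfstK, csndK).
apply: run_pair => //; apply: (@run_mu _ _ _ _ (fun=> 0%N)).
  by have := cP' p (cpair n T); rewrite !(cfstK, csndK) PT.
move=> k kT; have := cP' p (cpair n k); rewrite !(cfstK, csndK).
by case: (boolP (P p n k)) => // /minT; rewrite leqNgt kT.
Qed.

(** Replacing each oracle call by [CZero] turns a program run on the zero oracle into one that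
    behaves alike on all oracles. *)
Lemma computable_seqP u : computable_seq u <-> cfun (fun _ n => u n).
Proof.
split=> [[c cu]|[c cu]]; last by exists c.
exists (let fix z c := match c with
  | COracle => CZero
  | CPair a b => CPair (z a) (z b) | CComp a b => CComp (z a) (z b)
  | CPrec a b => CPrec (z a) (z b) | CMu a => CMu (z a) | _ => c end in z c) => p n.
elim: (cu n) => {c cu u n}; by intros; econstructor; eauto.
Qed.

(* States of a search: 0 once an undefined value is met, 1 while no zero is found,
   k.+2 once the least zero k is found. *)
Definition mu_step (e : nat -> nat) (k r : nat) : nat :=
  if r == 1%N then if e k == 0%N then 0%N else if e k == 1%N then k.+2 else 1%N else r.

Lemma mu_stepP e t :
  match iteri t (mu_step e) 1%N with
  | 0 => True
  | 1 => forall k, (k < t)%N -> (1 < e k)%N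
  | v.+2 => e v = 1%N /\ forall k, (k < v)%N -> (1 < e k)%N
  end.
Proof.
elim: t => [|t] //=; rewrite {2}/mu_step.
case: (iteri t _ 1%N) => [|[|v]] //= h.
case E: (e t) => [|[|w]] //= k; rewrite ltnS leq_eqVlt => /orP[/eqP->|/h//].
by rewrite E.
Qed.

(* The fuel t bounds searches; values of the oracle and of the result are shifted
   by one, 0 standing for an undefined value. *)
Fixpoint evalb (c : prog) (o : nat -> nat) (t n : nat) : nat :=
  match c with
  | CZero => 1
  | CSucc => n.+2
  | CFst => (cfst n).+1
  | CSnd => (csnd n).+1
  | COracle => o n
  | CPair c d =>
      if (0 < evalb c o t n)%N && (0 < evalb d o t n)%N
      then (cpair (evalb c o t n).-1 (evalb d o t n).-1).+1 else 0
  | CComp c d =>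
      if (0 < evalb d o t n)%N then evalb c o t (evalb d o t n).-1 else 0
  | CPrec c d =>
      iteri (csnd n) (fun k r =>
        if (0 < r)%N then evalb d o t (cpair (cfst n) (cpair k r.-1)) else 0)
      (evalb c o t (cfst n))
  | CMu c =>
      (iteri t (mu_step (fun k => evalb c o t (cpair n k))) 1).-1
  end%N.

(** By induction on the fixed program [c]. The oracle table may itself depend computably on [p] and
    [n], so that searches can run [c] on guessed finite oracles. *)
Lemma cf_evalb c O T X : cfun2 O -> cfun T -> cfun X ->
  cfun (fun p n => evalb c (O p n) (T p n) (X p n)).
Proof.
have sh O1 F : cfun2 O1 -> cfun F -> cfun2 (fun p m => O1 p (F p m)).
  by move=> cO1 cF; apply: (cf2 cO1); [exact: (cf_comp cF (cf_fst cf_id))|exact: cf_snd cf_id].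
elim: c O T X => [||||| c IHc d IHd | c IHc d IHd | c IHc d IHd | c IHc] O T X cO cT cX /=;
  rewrite /mu_step; cf.
- exact: IHc.
- exact: IHd.
- exact: IHc.
- exact: IHd.
- exact: IHd.
- by apply: IHc => //; cf; exact: IHd.
- by apply: IHc => //; cf.
- apply: (@IHd (fun p m => O p (cfst m)) (fun p m => T p (cfst m))).
  + by apply: sh => //; cf.
  + exact: (cf_comp cT (cf_fst cf_id)).
  + by cf; exact: (cf_comp cX (cf_fst cf_id)).
all: apply: (@IHc (fun p m => O p (cfst m)) (fun p m => T p (cfst m)));
  [by apply: sh => //; cf | exact: (cf_comp cT (cf_fst cf_id))
  | by cf; exact: (cf_comp cX (cf_fst cf_id))].
Qed.

Lemma evalb_sound p o c t n m : (forall i v, o i = v.+1 -> p i = v) ->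
  evalb c o t n = m.+1 -> run p c n m.
Proof.
move=> op; elim: c n m => [||||| c IHc d IHd | c IHc d IHd | c IHc d IHd | c IHc] n m /=.
- by case=> <-; constructor.
- by case=> <-; constructor.
- by case=> <-; constructor.
- by case=> <-; constructor.
- by move=> /op <-; constructor.
- case E: (evalb c o t n) => [|a] //; case E': (evalb d o t n) => [|b] //=.
  by case=> <-; apply: run_pair; [exact: IHc|exact: IHd].
- by case E: (evalb d o t n) => [|a] //= h; apply: run_comp; [exact: IHd E|exact: IHc].
- move=> h; rewrite -[n]cpairK; move: h; elim: (csnd n) m => [|k IH] m /=.
    by move=> h; apply: run_prec0; exact: IHc.
  case E: (iteri _ _ _) => [|r] //= h.
  by apply: run_precS; [exact: IH E|exact: IHd].
- have := mu_stepP (fun k => evalb c o t (cpair n k)) t.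
  case: (iteri t _ 1%N) => [|[|v]] //= [ev lt] [<-].
  (* Below [v] the shifted values exceed 1, so the true values are positive, as [run_mu] asks. *)
  apply: (@run_mu _ _ _ _ (fun k => (evalb c o t (cpair n k)).-2)); first exact: IHc.
  by move=> k /lt h; apply: IHc; move: h; case: (evalb _ _ _ _) => [|[]].
Qed.

Lemma bounded_choice n (Q : nat -> nat -> Prop) :
  (forall k B B', (B <= B')%N -> Q k B -> Q k B') ->
  (forall k, (k < n)%N -> exists B, Q k B) -> exists B, forall k, (k < n)%N -> Q k B.
Proof.
move=> mono; elim: n => [|n IH] h; first by exists 0%N.
have [B1 h1] := IH (fun k kn => h k (ltnW kn)); have [B2 h2] := h n (ltnSn n).
exists (maxn B1 B2) => k; rewrite ltnS leq_eqVlt => /orP[/eqP->|/h1].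
  by apply: mono h2; rewrite leq_maxr.
by apply: mono; rewrite leq_maxl.
Qed.

(** A halting run takes finitely many steps and reads finitely many oracle values, so one [B] bounds
    both the fuel and the queries. *)
Lemma evalb_complete p c n m : run p c n m -> exists B, forall o t, (B <= t)%N ->
  (forall i, (i < B)%N -> o i = (p i).+1) -> evalb c o t n = m.+1.
Proof.
elim=> {c n m}.
- by exists 0%N.
- by exists 0%N.
- by exists 0%N.
- by exists 0%N.
- by move=> n; exists n.+1 => o t _ h /=; rewrite h.
- move=> c d n a b _ [B1 h1] _ [B2 h2]; exists (maxn B1 B2) => o t /=; rewrite geq_max.
  move=> /andP[t1 t2] ho; rewrite (h1 o t) // ?(h2 o t) // => i iB; apply: ho.
    by rewrite leq_max iB orbT.
  by rewrite leq_max iB.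
- move=> c d n a b _ [B1 h1] _ [B2 h2]; exists (maxn B1 B2) => o t /=; rewrite geq_max.
  move=> /andP[t1 t2] ho; rewrite (h1 o t) // ?(h2 o t) // => i iB; apply: ho.
    by rewrite leq_max iB orbT.
  by rewrite leq_max iB.
- by move=> c d a b _ [B h]; exists B => o t Bt ho /=; rewrite cfstK csndK /= (h o t).
- move=> c d a n r b _ [B1 h1] _ [B2 h2]; exists (maxn B1 B2) => o t /=; rewrite geq_max.
  move=> /andP[t1 t2] ho; rewrite cfstK csndK /=.
  have := h1 o t t1; rewrite /= cfstK csndK => -> /= => [|i iB]; last first.
    by apply: ho; rewrite leq_max iB.
  by apply: h2 => // i iB; apply: ho; rewrite leq_max iB orbT.
- move=> c a n h _ [B1 h1] _ IH.
  have [|B2 h2] := bounded_choice _ IH.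
    move=> k B B' BB' h2 o t tB ho; apply: h2; first exact: leq_trans tB.
    by move=> i iB; apply: ho; exact: leq_trans iB BB'.
  (* The search tests [n] in round [n.+1], so the fuel must exceed [n]; from then on the state stays
     at [n.+2]. *)
  exists (maxn n.+1 (maxn B1 B2)) => o t /=.
  rewrite !geq_max => /and3P[nt t1 t2] ho.
  have e0 : evalb c o t (cpair a n) = 1%N.
    by apply: h1 => // i iB; apply: ho; rewrite !leq_max iB orbT.
  have e1 k : (k < n)%N -> evalb c o t (cpair a k) = (h k).+2.
    by move=> kn; apply: h2 => // i iB; apply: ho; rewrite !leq_max iB !orbT.
  set r := mu_step _.
  have s1 j : (j <= n)%N -> iteri j r 1%N = 1%N.
    by elim: j => [|j IHj] // jn /=; rewrite IHj ?(ltnW jn) // /r /mu_step /= e1.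
  suff s2 j : iteri (n.+1 + j) r 1%N = n.+2 by rewrite -(subnKC nt) s2.
  elim: j => [|j IHj]; first by rewrite addn0 /= s1 // /r /mu_step /= e0.
  by rewrite addnS -[LHS]/(r _ (iteri (n.+1 + j) r 1%N)) IHj.
Qed.

(** Both outputs are the value of [evalb] on the full oracle with enough fuel. *)
Lemma run_det p c n m m' : run p c n m -> run p c n m' -> m = m'.
Proof.
move=> /evalb_complete[B h] /evalb_complete[B' h'].
have := h (fun i => (p i).+1) _ (leq_maxl B B') (fun i _ => erefl).
by rewrite (h' _ _ (leq_maxr B B') (fun i _ => erefl)) => -[].
Qed.

Ltac cf_more ::= lazymatch goal with
  | |- cfun (fun p n => evalb ?c (@?O p n) (@?T p n) (@?X p n)) => apply: (@cf_evalb c O T X)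
  | |- cfun2 _ => rewrite /cfun2
  end.

(** * Computable rationals, compactness of Cantor space, binary expansions *)

Section ComputableRationals.
Variable R : realType.
Implicit Types Q : (nat -> nat) -> nat -> R.

(** Rationals are handled through their codes for [ratn]. Codes are not unique, so comparisons are
    decided by cross-multiplication. *)
Definition crat Q : Prop :=
  exists2 E, cfun E & forall p n, Q p n = ratn R (E p n).

Lemma ratnE a b c : ratn R (cpair a (cpair b c)) = (a%:R - b%:R) / c.+1%:R.
Proof. by rewrite /ratn !(cfstK, csndK). Qed.

Lemma ratn_frac a c : ratn R (cpair a (cpair 0 c)) = a%:R / c.+1%:R.
Proof. by rewrite ratnE subr0. Qed.

Lemma half_expE k : 2^-1 ^+ k = 1 / ((2 ^ k).-1.+1)%:R :> R.
Proof. by rewrite prednK ?expn_gt0 // natrX exprVn mul1r. Qed.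

Lemma crat_ratn F : cfun F -> crat (fun p n => ratn R (F p n)).
Proof. by exists F. Qed.

Lemma crat_frac F G : cfun F -> cfun G -> crat (fun p n => (F p n)%:R / (G p n).+1%:R).
Proof.
move=> cF cG; exists (fun p n => cpair (F p n) (cpair 0 (G p n))); first by cf.
by move=> p n; rewrite ratn_frac.
Qed.

Lemma crat_nat F : cfun F -> crat (fun p n => (F p n)%:R).
Proof.
move=> cF; have [E cE h] := crat_frac cF (cf_const 0).
by exists E => // p n; rewrite -h divr1.
Qed.

Lemma crat_half F : cfun F -> crat (fun p n => 2^-1 ^+ F p n).
Proof.
move=> cF; have cG : cfun (fun p n => (2 ^ F p n).-1) by cf.
have [E cE h] := crat_frac (cf_const 1) cG.
by exists E => // p n; rewrite -h half_expE.
Qed.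

Lemma crat_opp Q : crat Q -> crat (fun p n => - Q p n).
Proof.
move=> [E cE h].
exists (fun p n => cpair (cfst (csnd (E p n))) (cpair (cfst (E p n)) (csnd (csnd (E p n))))).
  by cf.
by move=> p n; rewrite ratnE h /ratn -mulNr opprB.
Qed.

Lemma crat_add Q Q' : crat Q -> crat Q' -> crat (fun p n => Q p n + Q' p n).
Proof.
move=> [E cE h] [E' cE' h'].
exists (fun p n =>
  let a := cfst (E p n) in let b := cfst (csnd (E p n)) in let c := csnd (csnd (E p n)) in
  let a' := cfst (E' p n) in let b' := cfst (csnd (E' p n)) in
  let c' := csnd (csnd (E' p n)) in
  cpair (a * c'.+1 + a' * c.+1) (cpair (b * c'.+1 + b' * c.+1) (c.+1 * c'.+1).-1))%N.
  by cbv zeta; cf.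
move=> p n; rewrite ratnE h h' /ratn prednK // !natrD !natrM.
have := pnatr_eq0 R (csnd (csnd (E p n))).+1; have := pnatr_eq0 R (csnd (csnd (E' p n))).+1.
move: (_.+1%:R) (_.+1%:R) => c c' /= c0 c'0.
by field; rewrite ?c0 ?c'0.
Qed.

Lemma crat_mul Q Q' : crat Q -> crat Q' -> crat (fun p n => Q p n * Q' p n).
Proof.
move=> [E cE h] [E' cE' h'].
exists (fun p n =>
  let a := cfst (E p n) in let b := cfst (csnd (E p n)) in let c := csnd (csnd (E p n)) in
  let a' := cfst (E' p n) in let b' := cfst (csnd (E' p n)) in
  let c' := csnd (csnd (E' p n)) in
  cpair (a * a' + b * b') (cpair (a * b' + b * a') (c.+1 * c'.+1).-1))%N.
  by cbv zeta; cf.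
move=> p n; rewrite ratnE h h' /ratn prednK // !natrD !natrM.
have := pnatr_eq0 R (csnd (csnd (E p n))).+1; have := pnatr_eq0 R (csnd (csnd (E' p n))).+1.
move: (_.+1%:R) (_.+1%:R) => c c' /= c0 c'0.
by field; rewrite ?c0 ?c'0.
Qed.

Lemma crat_lt Q Q' : crat Q -> crat Q' -> cfun (fun p n => nat_of_bool (Q p n < Q' p n)).
Proof.
move=> [E cE h] [E' cE' h'].
have : cfun (fun p n =>
  let a := cfst (E p n) in let b := cfst (csnd (E p n)) in let c := csnd (csnd (E p n)) in
  let a' := cfst (E' p n) in let b' := cfst (csnd (E' p n)) in
  let c' := csnd (csnd (E' p n)) in
  nat_of_bool (a * c'.+1 + b' * c.+1 < a' * c.+1 + b * c'.+1)%N).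
  by cbv zeta; cf.
apply: cfun_ext => p n /=; congr nat_of_bool; rewrite h h' /ratn.
rewrite ltr_pdivrMr ?ltr0n // mulrAC ltr_pdivlMr ?ltr0n // -(ltr_nat R) !natrD !natrM.
by apply/idP/idP => h0; lra.
Qed.

Lemma crat_le Q Q' : crat Q -> crat Q' -> cfun (fun p n => nat_of_bool (Q p n <= Q' p n)).
Proof.
move=> cQ cQ'; apply: (cfun_ext _ (cf_neg (crat_lt cQ' cQ))) => p n.
by rewrite -leNgt.
Qed.

Lemma crat_if (A : (nat -> nat) -> nat -> bool) Q Q' :
  cfun (fun p n => nat_of_bool (A p n)) -> crat Q -> crat Q' ->
  crat (fun p n => if A p n then Q p n else Q' p n).
Proof.
move=> cA [E cE h] [E' cE' h'].
exists (fun p n => if A p n then E p n else E' p n); first by cf.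
by move=> p n; rewrite h h'; case: ifP.
Qed.

Lemma crat_ext Q Q' : (forall p n, Q p n = Q' p n) -> crat Q -> crat Q'.
Proof. by move=> e [E cE h]; exists E => // p n; rewrite -e. Qed.

Lemma crat_norm Q : crat Q -> crat (fun p n => `|Q p n|).
Proof.
move=> cQ; have c0 := crat_nat (cf_const 0).
apply: (crat_ext _ (crat_if (crat_le c0 cQ) cQ (crat_opp cQ))) => p n.
by case: ifPn => [/ger0_norm->//|]; rewrite -ltNge => /ltr0_norm.
Qed.

(** The ideal points of [unit_interval] are the [clamp (ratn R n)]. *)
Definition clamp (x : R) : R := Num.max 0 (Num.min 1 x).

Lemma clampP x : 0 <= clamp x <= 1.
Proof. by rewrite /clamp minElt; case: (ltP 1 x) => h1; rewrite maxElt; case: ltP => h2; lra. Qed.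

Lemma clamp_id x : 0 <= x <= 1 -> clamp x = x.
Proof. by rewrite /clamp minElt; case: (ltP 1 x) => h1; rewrite maxElt; case: ltP => h2; lra. Qed.

Lemma clamp_dist z x : 0 <= z <= 1 -> `|z - clamp x| <= `|z - x|.
Proof.
by move=> z01; rewrite /clamp minElt; case: (ltP 1 x) => h1; rewrite maxElt; case: ltP => h2 //; rewrite ler_norml;
  have := ler_norm (z - x); have := ler_norm (- (z - x)); rewrite normrN; lra.
Qed.

Lemma crat_clamp Q : crat Q -> crat (fun p n => clamp (Q p n)).
Proof.
move=> cQ; have c0 := crat_nat (cf_const 0); have c1 := crat_nat (cf_const 1).
have cm := crat_if (crat_lt c1 cQ) c1 cQ.
exact: (crat_ext _ (crat_if (crat_lt c0 cm) cm c0)).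
Qed.

End ComputableRationals.

Ltac cr_step :=
  cbn beta;
  lazymatch goal with
  | |- cfun (fun p n => nat_of_bool (@?F p n < @?G p n)%R) => apply: (@crat_lt _ F G)
  | |- cfun (fun p n => nat_of_bool (@?F p n <= @?G p n)%R) => apply: (@crat_le _ F G)
  | |- crat (fun p n => ratn _ (@?F p n)) => apply: (@crat_ratn _ F)
  | |- crat (fun p n => (2^-1 ^+ (@?F p n))%R) => apply: (@crat_half _ F)
  | |- crat (fun p n => ((@?F p n)%:R / (@?G p n).+1%:R)%R) => apply: (@crat_frac _ F G)
  | |- crat (fun p n => (@?F p n + @?G p n)%R) => apply: (@crat_add _ F G)
  | |- crat (fun p n => (@?F p n * @?G p n)%R) => apply: (@crat_mul _ F G)
  | |- crat (fun p n => (- @?F p n)%R) => apply: (@crat_opp _ F)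
  | |- crat (fun p n => `|@?F p n|%R) => apply: (@crat_norm _ F)
  | |- crat (fun p n => clamp (@?F p n)) => apply: (@crat_clamp _ F)
  | |- crat (fun p n => ((@?F p n)%:R)%R) => apply: (@crat_nat _ F)
  | |- crat (fun p n => 0%R) => apply: (crat_nat _ (cf_const 0))
  | |- crat (fun p n => 1%R) => apply: (crat_nat _ (cf_const 1))
  | |- crat (fun p n => if _ then _ else _) => apply: crat_if
  end.

Ltac cf_more ::= first [ cr_step | lazymatch goal with
  | |- cfun (fun p n => evalb ?c (@?O p n) (@?T p n) (@?X p n)) => apply: (@cf_evalb c O T X)
  | |- cfun2 _ => rewrite /cfun2
  end ].

(** * Criteria for Pi^0_1 sets and for computable maps *)

Section Spaces.
Variable R : realType.
Implicit Types (X Y : metric_space R).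

Lemma half_gt0 k : 0 < 2^-1 ^+ k :> R.
Proof. by rewrite exprn_gt0 // invr_gt0. Qed.

Lemma half_le1 k : 2^-1 ^+ k <= 1 :> R.
Proof. by rewrite exprn_ile1 // ?invr_ge0 ?invf_le1 // ler1n. Qed.

Lemma half_expS k : 2^-1 ^+ k = 2^-1 ^+ k.+1 + 2^-1 ^+ k.+1 :> R.
Proof. by rewrite exprS; lra. Qed.

Lemma half_le j k : (j <= k)%N -> 2^-1 ^+ k <= 2^-1 ^+ j :> R.
Proof. by move=> jk; rewrite ler_wiXn2l // ?invr_ge0 ?invf_le1 // ler1n. Qed.

Lemma half_lt_eps (e : R) : 0 < e -> exists k, forall j, (k <= j)%N -> 2^-1 ^+ j < e.
Proof.
move=> e0; have [k hk] : exists k, 2^-1 ^+ k < e.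
  exists (Num.bound e^-1); rewrite half_expE prednK ?expn_gt0 // div1r invf_plt //; last first.
    by rewrite posrE ltr0n expn_gt0.
  apply: lt_trans (archi_boundP _) _; first by rewrite invr_ge0 ltW.
  by rewrite ltr_nat ltn_expl.
by exists k => j kj; apply: le_lt_trans (half_le kj) hk.
Qed.

Lemma ratn_between (a b : R) : a < b -> exists n, a < ratn R n < b.
Proof.
move=> /rat_in_itvoo[q]; rewrite in_itv /= => h.
suff [n e] : exists n, ratn R n = ratr q by exists n; rewrite e.
have [m dm] : exists m, denq q = m.+1%:Z.
  by have := denq_gt0 q; case: (denq q) => [[|m]|] // _; exists m.
have qE : ratr q = (numq q)%:~R / m.+1%:R :> R by rewrite /ratr dm.
case nE : (numq q) qE => [k|k] ->.
  by exists (cpair k (cpair 0 m)); rewrite ratn_frac.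
by exists (cpair 0 (cpair k.+1 m)); rewrite ratnE sub0r NegzE mulrNz.
Qed.

Lemma weighted_le_sup (d : nat -> R) n : (forall k, 0 <= d k <= 1) ->
  2^-1 ^+ n * d n <= sup (range (fun k => 2^-1 ^+ k * d k)).
Proof.
move=> d01; apply: ub_le_sup; last by exists n.
exists 1 => _ [k _ <-]; have /andP[d0 d1] := d01 k.
by rewrite mulr_ile1 // ?half_le1 // ltW // half_gt0.
Qed.

Lemma weighted_sup_le (d : nat -> R) c : (forall k, 2^-1 ^+ k * d k <= c) ->
  sup (range (fun k => 2^-1 ^+ k * d k)) <= c.
Proof.
move=> h; apply: ge_sup; first by exists (2^-1 ^+ 0 * d 0%N), 0%N.
by move=> _ [k _ <-].
Qed.

(** [V m k] certifies that the ball of radius [2^-k] around the ideal point [m] misses [D]; the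
    certified balls must exhaust the complement within the carrier. *)
Lemma pi01_refutable X (D : set X) (V : nat -> nat -> bool) :
  cfun (fun _ n => nat_of_bool (V (cfst n) (csnd n))) ->
  D `<=` carrier X ->
  (forall x m, D x -> 0 <= sdist X (ideal X m) x) ->
  (forall x m k, D x -> V m k -> 2^-1 ^+ k <= sdist X (ideal X m) x) ->
  (forall x, carrier X x -> ~ D x -> exists m k, V m k /\ sdist X (ideal X m) x < 2^-1 ^+ k) ->
  pi01 X D.
Proof.
move=> cV DX d0 sound complete.
(* A pair rejected by [V] contributes a ball of radius 0, which misses [D]. *)
exists (fun n => cpair (cfst n) (if V (cfst n) (csnd n)
    then cpair 1 (2 ^ csnd n).-1 else cpair 0 0)).
  by apply/computable_seqP; cf.
apply/seteqP; split=> x.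
  move=> Dx; split; first exact: DX.
  move=> [n _]; rewrite /rational_ball /= cfstK csndK; case: ifP => [Vn|_].
    by rewrite cfstK csndK -half_expE ltNge sound.
  by rewrite cfstK csndK mul0r ltNge d0.
move=> [Xx nx]; apply: contrapT => Dx; apply: nx.
have [m [k [Vmk h]]] := complete x Xx Dx; exists (cpair m k) => //.
by rewrite /rational_ball /= !cfstK !csndK Vmk cfstK csndK -half_expE.
Qed.

(** The shape of all realizers below: search for a [T] that passes the test [P] and output [H].
    Every passing [T] is good enough, so the least one is. *)
Lemma computable_on_search X Y (D : set X) (F : X -> Y)
    (P : (nat -> nat) -> nat -> nat -> bool) (H : (nat -> nat) -> nat -> nat -> nat) :
  cfun (fun p m => nat_of_bool (P p (cfst m) (csnd m))) -> cfun2 H ->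
  (forall x, D x -> carrier Y (F x)) ->
  (forall x p n, D x -> cauchy_name X x p -> exists T, P p n T) ->
  (forall x p n T, D x -> cauchy_name X x p -> P p n T ->
     sdist Y (F x) (ideal Y (H p n T)) <= 2^-1 ^+ n) ->
  computable_on X Y D F.
Proof.
move=> cP cH DY ex ok; have [c hc] := cfun_mu cP cH; exists c => x Dx.
split; first exact: DY.
move=> p px; have [n|q qrun qE] := hc p; first exact: ex px.
exists q => // n; have [T PT ->] := qE n.
exact: ok px PT.
Qed.

End Spaces.

(** * Bit strings and compactness of Cantor space *)

Lemma bit0 s : bit s 0 = odd s. Proof. by []. Qed.

Lemma bitS s j : bit s j.+1 = bit s./2 j.
Proof. by rewrite /bit iterSr. Qed.

Lemma prefix_code (b : nat -> bool) L :
  exists2 s, (s < 2 ^ L)%N & forall j, (j < L)%N -> bit s j = b j.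
Proof.
elim: L b => [|L IH] b; first by exists 0%N.
have [s sL h] := IH (fun j => b j.+1); exists (b 0%N + s.*2)%N.
  by rewrite expnS; case: (b 0%N); lia.
move=> [_|j]; first by rewrite bit0 oddD odd_double addbF; case: (b 0%N).
by rewrite ltnS bitS half_bit_double; exact: h.
Qed.

(** Compactness of Cantor space, with [s] standing for the sequence of its bits. Without a uniform
    bound the tree of bad strings would have an infinite path, against the hypothesis for that
    path. *)
Lemma fan (Q : nat -> nat -> Prop) :
  (forall b : nat -> bool, exists B, forall L s, (B <= L)%N ->
     (forall j, (j < B)%N -> bit s j = b j) -> Q L s) ->
  exists B, forall L s, (B <= L)%N -> Q L s.
Proof.
move=> h; pose good (w : seq bool) := exists B, forall L s, (B <= L)%N ->
  (forall j, (j < size w)%N -> bit s j = nth false w j) -> Q L s.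
have good_rcons w : good (rcons w true) -> good (rcons w false) -> good w.
  move=> [B1 h1] [B2 h2]; exists (maxn B1 B2) => L s; rewrite geq_max => /andP[L1 L2] sw.
  have sw' b : bit s (size w) = b ->
      forall j, (j < size (rcons w b))%N -> bit s j = nth false (rcons w b) j.
    move=> sb j; rewrite size_rcons ltnS nth_rcons leq_eqVlt => /orP[/eqP->|jw].
      by rewrite ltnn eqxx.
    by rewrite jw sw.
  case E : (bit s (size w)); [exact: h1 L1 (sw' _ E)|exact: h2 L2 (sw' _ E)].
suff [B hB] : good [::] by exists B => L s BL; exact: hB.
apply: contrapT => bad.
(* The path appends [false] if that keeps the string bad, and otherwise [true], which is then bad by
   [good_rcons]. *)
pose w n := iter n (fun w => rcons w (~~ `[< ~ good (rcons w false) >])) [::].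
have w_bad n : ~ good (w n).
  elim: n => [|n IH] //=; case: asboolP => [//|/contrapT gf gt].
  by apply: IH; exact: good_rcons.
have w_size n : size (w n) = n by elim: n => //= n IH; rewrite size_rcons IH.
have w_nth n j : (j < n)%N -> nth false (w n) j = nth false (w j.+1) j.
  elim: n => // n IH; rewrite ltnS leq_eqVlt => /orP[/eqP->//|jn].
  by rewrite -IH //= nth_rcons w_size jn.
have [B hB] := h (fun j => nth false (w j.+1) j).
apply: (w_bad B); exists B => L s BL sw; apply: hB => // j jB.
by rewrite sw ?w_size // w_nth.
Qed.

(** * Binary expansions of points of the cube *)

Section BinaryExpansion.
Variable R : realType.

(** One bit sequence carries all coordinates: the digits of coordinate [n] sit at the positions
    [cpair n j]. This is the numerator over [2 ^ k] of the truncation to [k] digits. *)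
Definition bnum (b : nat -> bool) (n k : nat) : nat :=
  iteri k (fun j r => r + r + b (cpair n j))%N 0%N.

Definition bcode (b : nat -> bool) (n k : nat) : nat :=
  cpair (bnum b n k) (cpair 0 (2 ^ k).-1).

Definition bapp b n k : R := ratn R (bcode b n k).

Definition expands (b : nat -> bool) (z : nat -> R) : Prop :=
  forall n k, bapp b n k <= z n <= bapp b n k + 2^-1 ^+ k.

Lemma bappE b n k : bapp b n k = (bnum b n k)%:R * 2^-1 ^+ k.
Proof. by rewrite /bapp ratn_frac half_expE div1r. Qed.

Lemma bappS b n k : bapp b n k.+1 = bapp b n k + (b (cpair n k))%:R * 2^-1 ^+ k.+1.
Proof. by rewrite !bappE /= !natrD (half_expS R k); ring. Qed.

Lemma bapp_ext b b' n k : (forall j, (j < k)%N -> b (cpair n j) = b' (cpair n j)) ->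
  bcode b n k = bcode b' n k.
Proof.
move=> h; congr cpair; elim: k h => //= k IH h.
by rewrite IH ?h // => j jk; apply: h; exact: ltnW.
Qed.

Lemma bapp_bound b n k j : (k <= j)%N ->
  bapp b n k <= bapp b n j <= bapp b n k + 2^-1 ^+ k - 2^-1 ^+ j.
Proof.
move=> /subnKC <-; elim: (j - k)%N => [|i IH]; first by rewrite addn0; lra.
rewrite addnS bappS; have := half_expS R (k + i); have := half_gt0 R (k + i).+1.
by case: (b _); rewrite ?mul1r ?mul0r; lra.
Qed.

Lemma bapp01 b n k : 0 <= bapp b n k <= 1.
Proof.
have := @bapp_bound b n 0 k isT; rewrite (bappE b n 0) mul0r expr0.
by have := half_gt0 R k; lra.
Qed.

Lemma expands_ex b : exists z, expands b z.
Proof.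
exists (fun n => sup (range (bapp b n))) => n k; apply/andP; split.
  apply: ub_le_sup; last by exists k.
  by exists 1 => _ [j _ <-]; have := bapp01 b n j; lra.
apply: ge_sup; first by exists (bapp b n 0), 0%N.
move=> _ [j _ <-]; have h1 := bapp_bound b n (leq_maxr k j).
have h2 := bapp_bound b n (leq_maxl k j).
by have := half_gt0 R (maxn k j); lra.
Qed.

Lemma expands01 b z n : expands b z -> 0 <= z n <= 1.
Proof. by move=> /(_ n 0%N); rewrite bappE mul0r expr0 add0r. Qed.

Lemma expands_surj (z : nat -> R) : (forall n, 0 <= z n <= 1) -> exists b, expands b z.
Proof.
move=> z01.
(* [u n k] is the remainder after [k] digits, an orbit of the doubling map; the next digit is 1 iff
   the remainder is at least 1/2. The remainder 1 is fixed and yields only digits 1. *)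
pose u n k := iter k (fun u : R => u + u - (2^-1 <= u)%R%:R) (z n).
have u01 n k : 0 <= u n k <= 1.
  elim: k => [|k] /=; first exact: z01.
  by rewrite -/(u n k); case: (leP (2^-1) (u n k)) => /=; lra.
exists (fun i => (2^-1 <= u (cfst i) (csnd i))%R) => n k.
set b := fun _ => _.
suff -> : z n = bapp b n k + u n k * 2^-1 ^+ k.
  have := half_gt0 R k; have := u01 n k; move: (u n k) (2^-1 ^+ k) => v e; nra.
elim: k => [|k IH]; first by rewrite bappE mul0r expr0 mulr1 add0r.
rewrite IH bappS [u n k.+1]/= -/(u n k) /b cfstK csndK (half_expS R k); ring.
Qed.

End BinaryExpansion.

Lemma cf_bcode S N K : cfun S -> cfun N -> cfun K ->
  cfun (fun p n => bcode (bit (S p n)) (N p n) (K p n)).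
Proof.
move=> cS cN cK; rewrite /bcode /bnum; cf.
all: by apply: (cf_comp _ (cf_fst cf_id)).
Qed.

(** * Addresses *)

(** The code, in the sense of [entry], of [g 0], ..., [g k.-1] followed by zeros; it is built from
    the last entry backwards. *)
Definition encode (g : nat -> nat) (k : nat) : nat :=
  iteri k (fun l r => cpair (g (k - l.+1)%N) r) 0%N.

Lemma entry_encode g k i : entry (encode g k) i = if (i < k)%N then g i else 0%N.
Proof.
have e0 j : entry 0 j = 0%N.
  have c0 : csnd 0 = 0%N by [].
  by rewrite /entry; elim: j => //= j IH; rewrite -iterS iterSr c0.
have eS a n j : entry (cpair a n) j = if j is j'.+1 then entry n j' else a.
  by case: j => [|j]; rewrite /entry ?iterSr ?csndK //= cfstK.
rewrite /encode; set h := fun _ _ => _.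
suff H l : (l <= k)%N -> entry (iteri l h 0%N) i =
    if (i < l)%N then g (k - l + i)%N else 0%N by rewrite H // subnn.
elim: l i => [|l IH] i lk; first by rewrite e0.
rewrite [iteri _ _ _]/= /h eS -/h; case: i => [|i]; first by rewrite addn0.
by rewrite IH ?(ltnW lk) // ltnS; case: ifP => // _; congr g; lia.
Qed.

Lemma cf_encode (G : (nat -> nat) -> nat -> nat -> nat) K : cfun K ->
  cfun (fun p m => G p (cfst m) (csnd m)) -> cfun (fun p n => encode (G p n) (K p n)).
Proof.
move=> cK cG; rewrite /encode.
apply: (@cf_rec (fun _ _ => 0%N) K (fun p n l r => cpair (G p n (K p n - l.+1)%N) r)); cf.
apply: (@cf2 G); cf.
exact: (cf_comp cK (cf_fst cf_id)).
Qed.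

(** * Distances to ideal points in the Hilbert cube and in the product of the line with Cantor
    space *)

Section Distances.
Variable R : realType.

Lemma cube_dist_ge (z : hilbert_cube R) m n : (forall k, 0 <= z k <= 1) ->
  2^-1 ^+ n * `|z n - clamp (ratn R (entry m n))|
    <= sdist (hilbert_cube R) z (ideal (hilbert_cube R) m).
Proof.
move=> z01.
apply: (@weighted_le_sup R (fun k => `|z k - clamp (ratn R (entry m k))|)) => k.
by have := clampP (ratn R (entry m k)); have := z01 k; rewrite normr_ge0 ler_norml; lra.
Qed.

Lemma cube_dist_near (z : hilbert_cube R) m n k : (forall k, 0 <= z k <= 1) ->
  sdist (hilbert_cube R) z (ideal (hilbert_cube R) m) <= 2^-1 ^+ (k + n) ->
  `|z n - clamp (ratn R (entry m n))| <= 2^-1 ^+ k.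
Proof.
move=> z01 h; have := le_trans (cube_dist_ge m n z01) h.
by rewrite exprD mulrC ler_pM2r // half_gt0.
Qed.

(** Coordinates from [n] on weigh at most [2^-n], so it suffices to approximate the first [n]. *)
Lemma cube_dist_encode (z : hilbert_cube R) g n : (forall k, 0 <= z k <= 1) ->
  (forall i, (i < n)%N -> `|z i - ratn R (g i)| <= 2^-1 ^+ n) ->
  sdist (hilbert_cube R) z (ideal (hilbert_cube R) (encode g n)) <= 2^-1 ^+ n.
Proof.
move=> z01 h; apply: (@weighted_sup_le R (fun k => `|z k - clamp (ratn R (entry (encode g n) k))|)).
move=> k; rewrite entry_encode; case: ltnP => [/h hk|nk].
  apply: le_trans hk; apply: le_trans (clamp_dist _ (z01 k)).
  by rewrite ler_piMl // half_le1.
apply: le_trans (half_le R nk); rewrite ler_piMr ?(ltW (half_gt0 R k)) //.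
by have := clampP (ratn R 0); have := z01 k; rewrite ler_norml; lra.
Qed.

Lemma cube_dense (z : hilbert_cube R) k : (forall k, 0 <= z k <= 1) ->
  exists m, sdist (hilbert_cube R) z (ideal (hilbert_cube R) m) < 2^-1 ^+ k.
Proof.
move=> z01; have h i : exists q, `|z i - ratn R q| <= 2^-1 ^+ k.+1.
  have [|q] := @ratn_between R (z i) (z i + 2^-1 ^+ k.+1); first by rewrite ltrDl half_gt0.
  by exists q; rewrite ler_norml; lra.
exists (encode (fun i => xchoose (h i)) k.+1).
apply: (@le_lt_trans _ _ (2^-1 ^+ k.+1)); last by have := half_expS R k; have := half_gt0 R k.+1; lra.
by apply: cube_dist_encode => // i _; exact: (xchooseP (h i)).
Qed.

Lemma cube_dist_sym (z z' : hilbert_cube R) :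
  sdist (hilbert_cube R) z z' = sdist (hilbert_cube R) z' z.
Proof.
rewrite /=; congr sup; congr image; apply/funext => n; congr (_ * _); exact: distrC.
Qed.

Lemma real_cantor_dist_ge (y : @real_cantor R) m :
  `|y.1 - ratn R (cfst m)| <= sdist real_cantor y (ideal real_cantor m).
Proof. by rewrite /= le_max lexx. Qed.

(** A disagreement at place [j] would alone contribute [2^-j], which exceeds [2^-k]. *)
Lemma real_cantor_near (y : @real_cantor R) m k j : (j < k)%N ->
  sdist real_cantor y (ideal real_cantor m) <= 2^-1 ^+ k ->
  odd (entry (csnd m) j) = y.2 j.
Proof.
move=> jk; rewrite /= ge_max => /andP[_ h].
have d01 i : 0 <= ((y.2 i != odd (entry (csnd m) i))%:R : R) <= 1.
  by case: (_ != _); rewrite ?lexx ?ler01.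
have := le_trans (weighted_le_sup j d01) h.
case: eqVneq => //= _; rewrite mulr1 => /(le_trans _); move=> /(_ _ (lexx _)).
have := half_le R jk; have := half_expS R j; have := half_gt0 R j.+1; lra.
Qed.

Lemma real_cantor_dist_le (y : @real_cantor R) q g n :
  `|y.1 - ratn R q| <= 2^-1 ^+ n -> (forall i, (i < n)%N -> odd (g i) = y.2 i) ->
  sdist real_cantor y (ideal real_cantor (cpair q (encode g n))) <= 2^-1 ^+ n.
Proof.
move=> hq h; rewrite /= ge_max cfstK hq csndK /=.
apply: (@weighted_sup_le R (fun k => (y.2 k != odd (entry (encode g n) k))%:R)) => k.
rewrite entry_encode; case: ltnP => [/h ->|nk].
  by rewrite eqxx mulr0 ltW // half_gt0.
apply: le_trans (half_le R nk).
by rewrite ler_piMr ?(ltW (half_gt0 R k)) //; case: (_ != _); rewrite /= ?lexx ?ler01.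
Qed.

Lemma real_cantor_dense (y : @real_cantor R) k :
  exists m, sdist real_cantor y (ideal real_cantor m) < 2^-1 ^+ k.
Proof.
have [|q hq] := @ratn_between R y.1 (y.1 + 2^-1 ^+ k.+1); first by rewrite ltrDl half_gt0.
exists (cpair q (encode (fun i => nat_of_bool (y.2 i)) k.+1)).
apply: (@le_lt_trans _ _ (2^-1 ^+ k.+1)); last by have := half_expS R k; have := half_gt0 R k.+1; lra.
by apply: real_cantor_dist_le => [|i _]; [rewrite ler_norml; lra|exact: oddb].
Qed.

Lemma real_cantor_dist_sym (y y' : @real_cantor R) :
  sdist real_cantor y y' = sdist real_cantor y' y.
Proof.
rewrite /= distrC; congr Num.max; congr sup; congr image.
by apply/funext => n; rewrite eq_sym.
Qed.

End Distances.

(** * Computability of the address map and of its inverse *)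

Section Embedding.
Variables (R : realType) (f : R -> R) (c : prog).
Hypothesis f_real : @realizes R unit_interval unit_interval c `[0, 1] f.
Variables (N : nat) (a : nat -> nat -> nat) (r : nat -> R).
Hypothesis a_comp : cfun (fun _ n => a (cfst n) (csnd n)).
Hypothesis a_approx : forall i k, `|r i - ratn R (a i k)| <= 2^-1 ^+ k.
Variables (idx : nat -> nat) (lo hi : nat -> R).
Hypothesis idx_comp : cfun (fun _ n => idx n).
Hypothesis lo_comp : crat (fun _ n => lo n).
Hypothesis hi_comp : crat (fun _ n => hi n).

Let K := inverse_limit f.

(** The common form of the set [D] in both cases: single coordinates are kept out of rational open
    intervals. *)
Definition avoiding : set K :=
  [set z | carrier K z /\ forall i, ~ lo i < z (idx i) < hi i].

Definition address (z : K) : @real_cantor R :=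
  (z N, fun j => z (N.+1 + cfst j)%N < r (csnd j)).

Hypothesis sep : forall z n i, avoiding z -> z (N.+1 + n)%N != r i.
Hypothesis address_inj : forall z z', avoiding z -> avoiding z' ->
  address z = address z' -> z = z'.

Lemma carrier01 (z : K) : carrier K z -> forall n, 0 <= z n <= 1.
Proof. by move=> [h _] n; have := h n; rewrite /= in_itv. Qed.

(** A ball controls coordinate [n] only up to the factor [2 ^ n], the inverse of its weight. A ball
    is certified when the resulting range of some coordinate lies in its forbidden interval. *)
Lemma avoiding_pi01 : pi01 K avoiding.
Proof.
pose V m k := has_lt k (fun i =>
  (lo i + (2 ^ idx i)%:R * 2^-1 ^+ k <= clamp (ratn R (entry m (idx i)))) &&
  (clamp (ratn R (entry m (idx i))) + (2 ^ idx i)%:R * 2^-1 ^+ k <= hi i)).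
have near (z : K) m k i : carrier K z -> sdist K (ideal K m) z < 2^-1 ^+ k ->
    `|z (idx i) - clamp (ratn R (entry m (idx i)))| < (2 ^ idx i)%:R * 2^-1 ^+ k.
  move=> Kz h; have := cube_dist_ge m (idx i) (carrier01 Kz); rewrite cube_dist_sym.
  move=> /le_lt_trans/(_ h); set d := `|_|.
  by rewrite half_expE prednK ?expn_gt0 // div1r mulrC ltr_pdivrMr ?ltr0n ?expn_gt0 // mulrC.
apply: (@pi01_refutable R K avoiding V).
- have sh F : crat (fun _ n => F n : R) -> forall G, cfun G -> crat (fun p n => F (G p n)).
    by move=> [E cE h] G cG; exists (fun p n => E p (G p n)); [exact: cf_comp cE cG|].
  have ci G : cfun G -> cfun (fun p n => idx (G p n)) by exact: cf_comp idx_comp.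
  rewrite /V; cf; try apply: (sh lo); try apply: (sh hi); cf; by apply: (ci _); cf.
- by move=> z [].
- move=> z m [Kz _]; rewrite cube_dist_sym.
  apply: le_trans (cube_dist_ge m 0 (carrier01 Kz)).
  by rewrite mulr_ge0 // ltW // half_gt0.
- move=> z m k [Kz nz] /has_ltP[i _ /andP[h1 h2]]; rewrite leNgt; apply/negP => d.
  apply: (nz i); have := near z m k i Kz d; rewrite ltr_norml; lra.
- move=> z Kz nz; have [i zi] : exists i, lo i < z (idx i) < hi i.
    by apply: contrapT => h; apply: nz; split => // i hi'; apply: h; exists i.
  (* Half the margin, since the range is entered once for the distance from [z] to the centre and
     once for the test; the last division compensates the weight of the coordinate. *)
  pose e := Num.min (z (idx i) - lo i) (hi i - z (idx i)) / 2 / (2 ^ idx i)%:R.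
  have e0 : 0 < e by rewrite !divr_gt0 ?ltr0n ?expn_gt0 // lt_min; lra.
  have [k0 hk0] := half_lt_eps e0; have := hk0 _ (leq_maxl k0 i.+1).
  set k := maxn k0 i.+1 => ek.
  have [m hm] := cube_dense k (carrier01 Kz); rewrite cube_dist_sym in hm.
  exists m, k; split => //; apply/has_ltP; exists i; first by rewrite leq_max ltnSn orbT.
  have := near z m k i Kz hm; move: ek.
  rewrite /e ltr_pdivlMr ?ltr0n ?expn_gt0 // mulrC ltr_pdivlMr // lt_min.
  by move=> /andP[]; rewrite ltr_norml; lra.
Qed.

(** Each bit is decided by approximations because [sep] excludes ties. *)
Lemma address_computable : computable_on K real_cantor avoiding address.
Proof.
have aC F G : cfun F -> cfun G -> cfun (fun p n => a (F p n) (G p n)).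
  exact: (@cf2 (fun _ => a)).
(* The weight of coordinate [n] turns the error [2^-(t + n)] of the name into an error [2^-t]
   there. *)
pose w (p : nat -> nat) n t := clamp (ratn R (entry (p (t + n)%N) n)).
have wC F G : cfun F -> cfun G -> crat (fun p n => w p (F p n) (G p n)).
  by move=> cF cG; rewrite /w; cf.
(* Stop when each of the first [n] comparisons shows, at some precision [t], a gap above the sum of
   both errors. *)
pose P (p : nat -> nat) n T := all_lt n (fun j => has_lt T (fun t =>
  2^-1 ^+ t + 2^-1 ^+ t < `|w p (N.+1 + cfst j)%N t - ratn R (a (csnd j) t)|)).
have [E cE hE] := wC _ _ (cf_const N) cf_id.
pose below (p : nat -> nat) T j := has_lt T (fun t =>
  w p (N.+1 + cfst j)%N t + (2^-1 ^+ t + 2^-1 ^+ t) < ratn R (a (csnd j) t)).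
pose H (p : nat -> nat) n T := cpair (E p n) (encode (fun j => nat_of_bool (below p T j)) n).
have wP (z : K) p n t : avoiding z -> cauchy_name K z p -> `|z n - w p n t| <= 2^-1 ^+ t.
  by move=> [Kz _] zp; apply: cube_dist_near (carrier01 Kz) (zp _).
apply: (@computable_on_search R K real_cantor avoiding address P H).
- rewrite /P; cf.
  + by apply: wC; cf.
  + by apply: aC; cf.
- rewrite /H /below /cfun2; cf.
  + exact: (cf_comp cE (cf_fst cf_id)).
  + apply: (@cf_encode (fun p m j => nat_of_bool (has_lt (csnd m) (fun t =>
      w p (N.+1 + cfst j)%N t + (2^-1 ^+ t + 2^-1 ^+ t) < ratn R (a (csnd j) t))))); cf.
    * by apply: wC; cf.
    * by apply: aC; cf.
- by move=> z _; split.
- move=> z p n Dz zp.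
  have [||T hT] := @bounded_choice n (fun j B => has_lt B (fun t =>
    2^-1 ^+ t + 2^-1 ^+ t < `|w p (N.+1 + cfst j)%N t - ratn R (a (csnd j) t)|)).
  + move=> j B B' BB' /has_ltP[t tB ht]; apply/has_ltP; exists t => //.
    exact: leq_trans tB BB'.
  + move=> j _; have := sep (cfst j) (csnd j) Dz; rewrite -subr_eq0 -normr_gt0 => e0.
    have [|t ht] := @half_lt_eps R (`|z (N.+1 + cfst j)%N - r (csnd j)| / 4); first by lra.
    exists t.+1; apply/has_ltP; exists t => //; move: (ht t (leqnn t)).
    have := wP z p (N.+1 + cfst j)%N t Dz zp; have := a_approx (csnd j) t.
    rewrite !ler_norml ltr_normr; case: (ger0P (_ - r _)); lra.
  + by exists T; apply/all_ltP.
- move=> z p n T Dz zp /all_ltP PT; apply: real_cantor_dist_le.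
    by rewrite -hE; exact: wP.
  move=> j jn; rewrite oddb /=; have /has_ltP[t tT ht] := PT j jn.
  have close t' := conj (wP z p (N.+1 + cfst j)%N t' Dz zp) (a_approx (csnd j) t').
  apply/idP/idP => [/has_ltP[t' _ ht']|zr].
    by have [] := close t'; rewrite !ler_norml; lra.
  apply/has_ltP; exists t => //; have [] := close t; move: ht.
  by rewrite ltr_normr !ler_norml => /orP[]; lra.
Qed.

(** The truncations of an expansion form a Cauchy name; this is the part of it known from [L]
    digits, in the format of [evalb], with 0 for undefined. *)
Definition digits_oracle (s L n i : nat) : nat :=
  if (cpair n i < L)%N then (bcode (bit s) n i).+1 else 0%N.

(* [ref_K], [ref_avoid], [ref_real], [ref_bits]: the first [L] binary digits of
   [s] already show that the sequence they begin is outside K, meets a forbidden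
   interval, or has an address far from the ideal point [m]. *)
Definition ref_K (s L : nat) : bool :=
  has_lt L (fun n => has_lt L (fun k =>
    [&& (cpair n k < L)%N, (0 < evalb c (digits_oracle s L n.+1) L k)%N &
      2^-1 ^+ k + 2^-1 ^+ k <
        `|clamp (ratn R (evalb c (digits_oracle s L n.+1) L k).-1)
            - ratn R (bcode (bit s) n k)|])).

Definition ref_avoid (s L : nat) : bool :=
  has_lt L (fun i => has_lt L (fun k =>
    [&& (cpair (idx i) k < L)%N, lo i < ratn R (bcode (bit s) (idx i) k) &
      ratn R (bcode (bit s) (idx i) k) + 2^-1 ^+ k < hi i])).

Definition ref_real (m s L : nat) : bool :=
  has_lt L (fun k => (cpair N k < L)%N &&
    (2^-1 ^+ k + 2^-1 ^+ L < `|ratn R (bcode (bit s) N k) - ratn R (cfst m)|)).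

Definition ref_bits (m s L : nat) : bool :=
  has_lt L (fun j => has_lt L (fun k => (cpair (N.+1 + cfst j) k < L)%N &&
    ((odd (entry (csnd m) j) && (ratn R (a (csnd j) k) + 2^-1 ^+ k <
        ratn R (bcode (bit s) (N.+1 + cfst j) k))) ||
     (~~ odd (entry (csnd m) j) && (ratn R (bcode (bit s) (N.+1 + cfst j) k)
        + 2^-1 ^+ k + 2^-1 ^+ k < ratn R (a (csnd j) k)))))).

Definition refuted (m s L : nat) : bool :=
  [|| ref_K s L, ref_avoid s L, ref_real m s L | ref_bits m s L].

Lemma cf_refuted M S L : cfun M -> cfun S -> cfun L ->
  cfun (fun p n => nat_of_bool (refuted (M p n) (S p n) (L p n))).
Proof.
have sh F : crat (fun _ n => F n : R) -> forall G, cfun G -> crat (fun p n => F (G p n)).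
  by move=> [E cE h] G cG; exists (fun p n => E p (G p n)); [exact: cf_comp cE cG|].
have ci G : cfun G -> cfun (fun p n => idx (G p n)) by exact: cf_comp idx_comp.
have aC F G : cfun F -> cfun G -> cfun (fun p n => a (F p n) (G p n)).
  exact: (@cf2 (fun _ => a)).
have cb S' N' K' : cfun S' -> cfun N' -> cfun K' ->
    cfun (fun p n => bcode (bit (S' p n)) (N' p n) (K' p n)) by exact: cf_bcode.
have co S' L' N' I' : cfun S' -> cfun L' -> cfun N' -> cfun I' ->
    cfun (fun p n => digits_oracle (S' p n) (L' p n) (N' p n) (I' p n)).
  by move=> cS cL cN cI; rewrite /digits_oracle; cf; apply: cb.
suff H : cfun (fun _ n => nat_of_bool (refuted (cfst n) (cfst (csnd n)) (csnd (csnd n)))).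
  move=> cM cS cL; have := cf_comp H (cf_pair cM (cf_pair cS cL)).
  by apply: cfun_ext => p n; rewrite !(cfstK, csndK).
rewrite /refuted /ref_K /ref_avoid /ref_real /ref_bits; cf;
  try apply: (sh lo); try apply: (sh hi); cf;
  try apply: co; try apply: cb; try apply: aC; cf; try apply: ci; cf.
Qed.

Lemma expands_name b z n : expands b z ->
  cauchy_name (@unit_interval R) (z n) (bcode b n).
Proof.
move=> bz k; change (`|z n - clamp (ratn R (bcode b n k))| <= 2^-1 ^+ k).
have := bz n k; have := bapp01 R b n k; rewrite /bapp => h; rewrite clamp_id //.
by rewrite ler_norml; lra.
Qed.

Lemma bcode_prefix b s L n k : (forall j, (j < L)%N -> bit s j = b j) ->
  (cpair n k < L)%N -> bcode (bit s) n k = bcode b n k.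
Proof.
move=> h nk; apply: bapp_ext => j jk; apply: h; apply: leq_ltn_trans nk.
by rewrite leq_cpair // ltnW.
Qed.

(** Each test leaves room for all approximation errors, so it never fires on the digits of a point
    of [avoiding] whose address is near [m]. *)
Lemma refuted_sound b (z : K) s L m : expands b z -> avoiding z ->
  (forall j, (j < L)%N -> bit s j = b j) ->
  sdist real_cantor (address z) (ideal real_cantor m) <= 2^-1 ^+ L -> ~~ refuted m s L.
Proof.
move=> bz [Kz nz] sb ym; apply/negP; rewrite /refuted => /or4P[].
- move=> /has_ltP[n nL /has_ltP[k kL /and3P[nk]]].
  case ev : (evalb _ _ _ _) => [|v] //= _.
  have [Fz /(_ _ (expands_name n.+1 bz))[q qrun qname]] := f_real (Kz.1 n.+1).
  have crun : run (bcode b n.+1) c k v.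
    apply: evalb_sound ev => i w; rewrite /digits_oracle; case: ifP => // iL [<-].
    by rewrite (bcode_prefix sb iL).
  have : `|z n - clamp (ratn R v)| <= 2^-1 ^+ k.
    by have := qname k; rewrite -(run_det crun (qrun k)) (Kz.2 n).
  rewrite (bcode_prefix sb nk); have := bz n k; rewrite /bapp !ler_norml ltr_normr => ? ? /orP[]; lra.
- move=> /has_ltP[i iL /has_ltP[k kL /and3P[nk]]]; rewrite (bcode_prefix sb nk) => h1 h2.
  by apply: (nz i); have := bz (idx i) k; rewrite /bapp; lra.
- move=> /has_ltP[k kL /andP[nk]]; rewrite (bcode_prefix sb nk).
  have := le_trans (real_cantor_dist_ge (address z) m) ym; rewrite /=.
  have := bz N k; rewrite /bapp !ler_norml ltr_normr => ? ? /orP[]; lra.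
- move=> /has_ltP[j jL /has_ltP[k kL /andP[nk]]]; rewrite (bcode_prefix sb nk).
  rewrite (real_cantor_near jL ym) /= => h; have := bz (N.+1 + cfst j)%N k.
  have := a_approx (csnd j) k; rewrite /bapp ler_norml.
  by move: h; case: ltP => /=; rewrite ?orbF; lra.
Qed.

(** Every way to fail is an open condition: it shows at finite precision, hence on finitely many
    digits. For a wrong bit this rests on [sep]. *)
Lemma refuted_complete b (z : K) (y : @real_cantor R) : expands b z ->
  ~ (avoiding z /\ address z = y) ->
  exists B, forall L s, (B <= L)%N -> (forall j, (j < B)%N -> bit s j = b j) ->
    forall m, sdist real_cantor y (ideal real_cantor m) <= 2^-1 ^+ L -> refuted m s L.
Proof.
move=> bz bad; have z01 := fun n => expands01 n bz.
have gap (e : R) n : 0 < e -> exists k B, [/\ (cpair n k < B)%N, (k < B)%N, 2^-1 ^+ k < e &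
    forall L, (B <= L)%N -> 2^-1 ^+ L < e].
  move=> /half_lt_eps[k hk]; exists k, (maxn (cpair n k) k).+1.
  rewrite !ltnS leq_maxl leq_maxr hk //; split => // L BL; apply: hk.
  by apply: leq_trans (ltnW BL); rewrite leq_maxr.
have pre B s n k : (forall j, (j < B)%N -> bit s j = b j) -> (cpair n k < B)%N ->
    bcode (bit s) n k = bcode b n k by exact: bcode_prefix.
case: (pselect (carrier K z)) => [Kz|nKz]; last first.
  have [n fn] : exists n, f (z n.+1) != z n.
    apply: contrapT => h; apply: nKz; split=> [n|n]; first by rewrite /= in_itv z01.
    by apply/eqP; apply: contrapT => /negP h'; apply: h; exists n.
  (* Four errors [2^-k] must fit: truncation, computed value, and the two in the threshold of
     [ref_K]. *)
  have e0 : 0 < `|f (z n.+1) - z n| / 4 by rewrite divr_gt0 // normr_gt0 subr_eq0.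
  have [k [B [nk kB ke _]]] := gap _ n e0.
  have [|Fz /(_ _ (expands_name n.+1 bz))[q qrun qname]] := @f_real (z n.+1).
    by rewrite /= in_itv z01.
  have [B' hB'] := evalb_complete (qrun k).
  exists (maxn (maxn n.+1 B) (maxn B' (cpair n.+1 B').+1)) => L s.
  rewrite !geq_max => /andP[/andP[nL BL] /andP[BL' nBL']] sb m _.
  apply/orP; left; apply/has_ltP; exists n => //; apply/has_ltP; exists k.
    exact: leq_trans kB BL.
  have ev : evalb c (digits_oracle s L n.+1) L k = (q k).+1.
    apply: hB' => // i iB'; have iC := leq_cpair (leqnn n.+1) (ltnW iB').
    rewrite /digits_oracle (leq_ltn_trans iC nBL') (pre _ _ _ _ sb) //.
    by apply: leq_trans (leq_maxr _ _); apply: leq_trans (leq_maxr _ _); rewrite ltnS.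
  rewrite ev (leq_trans nk BL) /= (pre _ _ _ _ sb) ?leq_max ?nk ?orbT //.
  have : `|f (z n.+1) - clamp (ratn R (q k))| <= 2^-1 ^+ k by exact: qname.
  move: ke; have := bz n k; rewrite /bapp !ler_norml !ltr_normr.
  by case: (ger0P (f _ - _)); lra.
case: (pselect (avoiding z)) => [Dz|nDz]; last first.
  have [i zi] : exists i, lo i < z (idx i) < hi i.
    by apply: contrapT => h; apply: nDz; split => // i hi'; apply: h; exists i.
  have e0 : 0 < Num.min (z (idx i) - lo i) (hi i - z (idx i)) / 2.
    by rewrite divr_gt0 // lt_min; lra.
  have [k [B [nk kB ke _]]] := gap _ (idx i) e0.
  exists (maxn B i.+1) => L s; rewrite geq_max => /andP[BL iL] sb m _.
  apply/or4P; apply: Or42; apply/has_ltP; exists i => //; apply/has_ltP; exists k.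
    exact: leq_trans kB BL.
  rewrite (leq_trans nk BL) /= (pre _ _ _ _ sb) ?leq_max ?nk //.
  by move: ke; rewrite ltr_pdivlMr // lt_min => /andP[]; have := bz (idx i) k; rewrite /bapp; lra.
have [zN|zN] := eqVneq (z N) y.1; last first.
  have e0 : 0 < `|z N - y.1| / 8 by rewrite divr_gt0 // normr_gt0 subr_eq0.
  have [k [B [nk kB ke Le]]] := gap _ N e0.
  exists B => L s BL sb m ym; apply/or4P; apply: Or43; apply/has_ltP; exists k.
    exact: leq_trans kB BL.
  rewrite (leq_trans nk BL) /= (pre _ _ _ _ sb) //.
  have := le_trans (real_cantor_dist_ge y m) ym; have := Le L BL; move: ke.
  have := bz N k; rewrite /bapp !ler_norml !ltr_normr.
  by case: (ger0P (z N - _)); lra.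
have [j yj] : exists j, (address z).2 j != y.2 j.
  apply: contrapT => h; apply: bad; split => //.
  rewrite [y]surjective_pairing -zN; congr pair; apply/funext => j.
  by apply/eqP; apply: contrapT => /negP h'; apply: h; exists j.
have e0 : 0 < `|z (N.+1 + cfst j)%N - r (csnd j)| / 8.
  by rewrite divr_gt0 // normr_gt0 subr_eq0 sep.
have [k [B [nk kB ke Le]]] := gap _ (N.+1 + cfst j)%N e0.
exists (maxn B j.+1) => L s; rewrite geq_max => /andP[BL jL] sb m ym.
apply/or4P; apply: Or44; apply/has_ltP; exists j => //; apply/has_ltP; exists k.
  exact: leq_trans kB BL.
rewrite (leq_trans nk BL) /= (pre _ _ _ _ sb) ?leq_max ?nk //.
rewrite (real_cantor_near jL ym); move: yj ke; rewrite /=.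
have := bz (N.+1 + cfst j)%N k; have := a_approx (csnd j) k; rewrite /bapp !ler_norml.
case: (y.2 j); rewrite /= ?orbF ?eqb_id.
  by rewrite -leNgt => ? ? h; rewrite ger0_norm; lra.
by rewrite eqbF_neg negbK => ? ? h; rewrite ltr0_norm; lra.
Qed.

Definition addresses : set (@real_cantor R) := [set address z | z in avoiding].

(** A ball of radius [2^-L] misses the image once all [2 ^ L] strings of [L] digits are refuted; by
    [fan] this happens around every point outside the image. *)
Lemma addresses_pi01 : pi01 real_cantor addresses.
Proof.
pose V m L := all_lt (2 ^ L) (fun s => refuted m s L).
apply: (@pi01_refutable R real_cantor addresses V).
- by rewrite /V; cf; apply: cf_refuted; cf.
- by [].
- move=> y m _; rewrite real_cantor_dist_sym.
  exact: le_trans (normr_ge0 _) (real_cantor_dist_ge y m).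
- move=> _ m L [z Dz <-] /all_ltP h; rewrite leNgt; apply/negP => ym.
  have [b bz] := expands_surj (carrier01 Dz.1); have [s sL sb] := prefix_code b L.
  rewrite real_cantor_dist_sym in ym.
  by have := refuted_sound bz Dz sb (ltW ym); rewrite h.
- move=> y _ ny.
  have [|B hB] := @fan (fun L s => forall m,
      sdist real_cantor y (ideal real_cantor m) <= 2^-1 ^+ L -> refuted m s L).
    move=> b; have [z bz] := expands_ex R b.
    by apply: (@refuted_complete b z y bz) => -[Dz zy]; apply: ny; exists z.
  have [m hm] := real_cantor_dense y B; exists m, B; split.
    by apply/all_ltP => s _; apply: hB => //; exact: ltW.
  by rewrite real_cantor_dist_sym.
Qed.

Definition of_address (y : @real_cantor R) : K :=
  xget (fun=> 0) [set z | avoiding z /\ address z = y].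

Lemma addressK z : avoiding z -> of_address (address z) = z.
Proof.
move=> Dz; rewrite /of_address; case: xgetP => [w _ [Dw]|/(_ z)[]//].
exact: address_inj.
Qed.

(** Search for a stage and a string [s0] such that all unrefuted strings are close to [s0]. The
    digits of the true point are never refuted, hence close; by injectivity only its expansions
    survive, so [fan] provides such a stage. *)
Lemma of_address_computable : computable_on real_cantor K addresses of_address.
Proof.
(* Closeness instead of equality, as a dyadic coordinate has two expansions. The tolerance plus one
   truncation error is below [2^-n]. *)
pose close s s0 n := all_lt n (fun i =>
  `|ratn R (bcode (bit s) i n.+2) - ratn R (bcode (bit s0) i n.+2)| <= 2^-1 ^+ n.+1).
(* [T] codes the stage and [s0]; a stage beyond [cpair n n.+2] contains all digits that are
   compared. *)
pose P (p : nat -> nat) n T := (cpair n n.+2 < cfst T)%N &&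
  all_lt (2 ^ cfst T) (fun s => refuted (p (cfst T)) s (cfst T) || close s (csnd T) n).
pose H (p : nat -> nat) n T := encode (fun i => bcode (bit (csnd T)) i n.+2) n.
have cl b s s0 (z : K) n : expands b z -> (forall i, (i < n)%N ->
    bcode (bit s) i n.+2 = bcode b i n.+2) ->
    close s s0 n = all_lt n (fun i => `|bapp R b i n.+2 - ratn R (bcode (bit s0) i n.+2)| <= 2^-1 ^+ n.+1).
  by move=> bz h; apply/all_ltP/all_ltP => h' i iN; have := h' i iN; rewrite /bapp h.
have avail n i L : (cpair n n.+2 < L)%N -> (i < n)%N -> (cpair i n.+2 < L)%N.
  by move=> nL iN; apply: leq_ltn_trans nL; rewrite leq_cpair // ltnW.
apply: (@computable_on_search R real_cantor K addresses of_address P H).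
- rewrite /P /close; cf; try apply: cf_refuted; cf; apply: cf_bcode; cf.
- rewrite /H /cfun2; apply: (@cf_encode (fun p m i => bcode (bit (csnd (csnd m))) i (cfst m).+2)); cf.
  by apply: cf_bcode; cf.
- by move=> _ [z Dz <-]; rewrite addressK //; case: Dz.
- move=> _ p n [z Dz <-] yp.
  have [b0 b0z] := expands_surj (carrier01 Dz.1).
  have [s0 _ s0b] := prefix_code b0 (cpair n n.+2).+1.
  have s0E i : (i < n)%N -> bcode (bit s0) i n.+2 = bcode b0 i n.+2.
    by move=> iN; apply: (bcode_prefix s0b); apply: avail iN.
  have [|B hB] := @fan (fun L s => refuted (p L) s L || close s s0 n).
    move=> b; have [w bw] := expands_ex R b.
    case: (pselect (avoiding w /\ address w = address z)) => [[Dw wz]|/(refuted_complete bw)[B hB]].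
      have E : w = z by exact: address_inj.
      exists (cpair n n.+2).+1 => L s BL sb; apply/orP; right.
      rewrite (cl _ _ _ _ _ bw) => [|i iN].
        apply/all_ltP => i iN; rewrite s0E //.
        have := bw i n.+2; have := b0z i n.+2; rewrite E /bapp ler_norml (half_expS R n.+1); lra.
      by apply: (bcode_prefix sb); apply: avail iN.
    by exists B => L s BL sb; rewrite hB.
  exists (cpair (maxn (cpair n n.+2).+1 B) s0); rewrite /P cfstK csndK leq_maxl /=.
  by apply/all_ltP => s _; apply: hB; rewrite leq_maxr.
- move=> _ p n T [z Dz <-] yp /andP[nL /all_ltP hT]; rewrite addressK //.
  have [b bz] := expands_surj (carrier01 Dz.1).
  have [s sL sb] := prefix_code b (cfst T).
  have := hT s sL; rewrite (negbTE (refuted_sound bz Dz sb (yp _))) /= (cl _ _ _ _ _ bz); last first.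
    by move=> i iN; apply: (bcode_prefix sb); apply: avail iN.
  move=> /all_ltP h; apply: cube_dist_encode; first exact: carrier01 Dz.1.
  move=> i /h; have := bz i n.+2; rewrite !ler_norml.
  have := half_expS R n; have := half_expS R n.+1; have := half_gt0 R n.+2; lra.
Qed.

Theorem address_tt_equiv z : avoiding z -> tt_equiv K z real_cantor (address z).
Proof.
move=> Dz; split.
  exists addresses, of_address; split; last exact: addressK.
  - exact: addresses_pi01.
  - exact: of_address_computable.
  - by exists z.
by exists avoiding, address; split => //; [exact: avoiding_pi01|exact: address_computable].
Qed.

End Embedding.

(** * Extrema of piecewise monotone functions *)

Section MonotonePieces.
Variable R : realType.
Implicit Types (f g : R -> R) (u v t : R).

(** A countable set is Lebesgue null, whereas the interval has positive measure. *)
Lemma countable_avoid (A : set R) u v : countable A -> u < v ->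
  exists t, u < t < v /\ ~ A t.
Proof.
move=> cA uv; apply: contrapT => h.
have sub : `]u, v[ `<=` A.
  by move=> t; rewrite /= in_itv /= => ut; apply: contrapT => At; apply: h; exists t.
have /countable_lebesgue_measure0 : countable `]u, v[%classic.
  exact: sub_countable (subset_card_le sub) cA.
rewrite lebesgue_measure_itv /= lte_fin uv -EFinB => -[] /eqP.
by rewrite subr_eq0 gt_eqF.
Qed.

Lemma near_right t v (Q : R -> Prop) : (\forall z \near t, Q z) -> t < v ->
  exists z, t < z < v /\ Q z.
Proof.
move=> /nbhs_ballP[e /= e0 h] tv; pose d := Num.min e (v - t) / 2.
have d0 : 0 < d by rewrite divr_gt0 // lt_min e0 subr_gt0.
have de : d < e by rewrite ltr_pdivrMr // gt_min; apply/orP; left; lra.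
have dv : d < v - t by rewrite ltr_pdivrMr // gt_min; apply/orP; right; lra.
exists (t + d); split; first lra.
by apply: h; rewrite /ball /= opprD addrA subrr sub0r normrN gtr0_norm.
Qed.

Lemma near_left t u (Q : R -> Prop) : (\forall z \near t, Q z) -> u < t ->
  exists z, u < z < t /\ Q z.
Proof.
move=> /nbhs_ballP[e /= e0 h] tv; pose d := Num.min e (t - u) / 2.
have d0 : 0 < d by rewrite divr_gt0 // lt_min e0 subr_gt0.
have de : d < e by rewrite ltr_pdivrMr // gt_min; apply/orP; left; lra.
have dv : d < t - u by rewrite ltr_pdivrMr // gt_min; apply/orP; right; lra.
exists (t - d); split; first lra.
by apply: h; rewrite /ball /= opprB addrC subrK gtr0_norm.
Qed.

Definition increasing_on g u v : Prop :=
  forall x y, u <= x -> x < y -> y <= v -> g x < g y.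

(** The sign lets increasing and decreasing functions be treated together. *)
Definition sg (b : bool) (x : R) : R := if b then x else - x.

Definition strictly_monotone f u v : Prop :=
  exists b, increasing_on (fun x => sg b (f x)) u v.

Lemma increasing_on_sub g u v u' v' : u <= u' -> v' <= v ->
  increasing_on g u v -> increasing_on g u' v'.
Proof.
by move=> uu vv h x y ux xy yv; apply: h => //; [exact: le_trans ux|exact: le_trans vv].
Qed.

Lemma strictly_monotone_sub f u v u' v' : u <= u' -> v' <= v ->
  strictly_monotone f u v -> strictly_monotone f u' v'.
Proof. by move=> uu vv [b h]; exists b; exact: increasing_on_sub h. Qed.

Lemma increasing_on_glue g u t v :
  increasing_on g u t -> increasing_on g t v -> increasing_on g u v.
Proof.
move=> h1 h2 x y ux xy yv; case: (leP y t) => [yt|ty]; first exact: h1.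
case: (leP t x) => [tx|xt]; first exact: h2.
exact: lt_trans (h1 x t ux xt (lexx _)) (h2 t y (lexx _) ty yv).
Qed.

(** Opposite directions on the two sides would make [t] a local extremum. *)
Lemma strictly_monotone_glue f u t v : 0 < t < 1 -> u < t -> t < v ->
  ~ local_extremum f t -> strictly_monotone f u t -> strictly_monotone f t v ->
  strictly_monotone f u v.
Proof.
move=> t01 ut tv next [b h1] [b' h2].
have [e|ne] := eqVneq b b'; first by exists b; subst b'; exact: increasing_on_glue h1 h2.
exfalso; apply: next; split => //.
have near_uv : \forall z \near t, z \in `]u, v[ by apply: near_in_itvoo; rewrite in_itv /= ut.
have peak z : z \in `]u, v[ -> sg b (f z) <= sg b (f t).
  rewrite in_itv /= => /andP[uz zv]; case: (ltgtP z t) => [zt|tz|->//].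
    by apply/ltW/h1 => //; exact: ltW.
  have := h2 t z (lexx _) tz (ltW zv).
  by move: ne; rewrite /sg; case: (b); case: (b') => //= _; lra.
move: peak; rewrite /sg; case: (b) => peak; [left|right]; near=> z.
  by apply: peak; near: z.
by rewrite -lerN2; apply: peak; near: z.
Unshelve. all: by end_near. Qed.

(** Equal directions on the two sides would give both larger and smaller values arbitrarily near
    [t]. *)
Lemma local_extremum_unimodal f t u v : u < t -> t < v -> local_extremum f t ->
  strictly_monotone f u t -> strictly_monotone f t v ->
  exists b, increasing_on (fun x => sg b (f x)) u t /\
            increasing_on (fun x => - sg b (f x)) t v.
Proof.
move=> ut tv [_ ext] [b h1] [b' h2]; exists b; split=> //.
suff ne : b' = ~~ b by move: h2; rewrite ne /sg; case: (b) => //= h x y *; rewrite !opprK; exact: h.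
case: (eqVneq b' b) => [e|]; last by case: (b); case: (b').
exfalso; subst b'; case: ext => near_t.
  have [zl [/andP[uz zt] hl]] := near_left near_t ut.
  have [zr [/andP[tz zv] hr]] := near_right near_t tv.
  have := h1 zl t (ltW uz) zt (lexx _); have := h2 t zr (lexx _) tz (ltW zv).
  by rewrite /sg; case: (b); lra.
have [zl [/andP[uz zt] hl]] := near_left near_t ut.
have [zr [/andP[tz zv] hr]] := near_right near_t tv.
have := h1 zl t (ltW uz) zt (lexx _); have := h2 t zr (lexx _) tz (ltW zv).
by rewrite /sg; case: (b); lra.
Qed.

Section Partition.
Variables (f : R -> R) (s : seq R).
Hypothesis f_fin : finite_to_one f.
Hypothesis s_part : itv_partition 0 1 s.
Hypothesis s_mono : forall i, (i < size s)%N ->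
  let J := `[nth 0 (0 :: s) i, nth 0 s i] in
  {in J &, {homo f : x y / x <= y}} \/ {in J &, {homo f : x y /~ x <= y}}.

Let P i := nth 0 (0 :: s) i.

Lemma breakpoint_lt i : (i < size s)%N -> P i < P i.+1.
Proof. by move=> iS; case: s_part => /(pathP 0) h _; exact: h. Qed.

Lemma breakpoint_le i j : (i <= j)%N -> (j <= size s)%N -> P i <= P j.
Proof.
move=> /subnKC <-; elim: (j - i)%N => [|k IH]; first by rewrite addn0.
rewrite addnS => kS; apply: le_trans (IH (ltnW kS)) _.
exact/ltW/breakpoint_lt.
Qed.

Lemma breakpoint_last : P (size s) = 1.
Proof. by case: s_part => _ /eqP; rewrite (last_nth 0). Qed.

(** Two equal values of a monotone piece would make [f] constant in between, on an uncountable set,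
    against finiteness of the fibres. *)
Lemma piece_strictly_monotone i : (i < size s)%N -> strictly_monotone f (P i) (P i.+1).
Proof.
move=> iS; have P0 : 0 <= P i by exact: (breakpoint_le (leq0n i) (ltnW iS)).
have P1 : P i.+1 <= 1 by rewrite -breakpoint_last; apply: breakpoint_le.
have flat x y : P i <= x -> x < y -> y <= P i.+1 ->
    (forall z, x <= z <= y -> f z = f x) -> False.
  move=> ix xy yi h; have [z [/andP[xz zy] []]] := countable_avoid (finite_set_countable (f_fin (f x))) xy.
  by split; [rewrite /= in_itv /=; lra|rewrite /= h // !ltW].
have inP x y z : P i <= x -> y <= P i.+1 -> x <= z <= y -> z \in `[P i, P i.+1].
  by move=> ix yi /andP[xz zy]; rewrite in_itv /= (le_trans ix xz) (le_trans zy yi).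
case: (s_mono iS) => h; [exists true|exists false] => x y ix xy yi /=;
  have {}inP := inP x y _ ix yi; have xx : x <= x <= y by rewrite lexx ltW.
  have yy : x <= y <= y by rewrite lexx ltW.
  rewrite lt_neqAle (h x y (inP _ xx) (inP _ yy) (ltW xy)) andbT; apply/eqP => e.
  apply: (flat x y) => // z zxy; have /andP[xz zy] := zxy; apply/eqP; rewrite eq_le {1}e.
  by rewrite (h z y (inP _ zxy) (inP _ yy) zy) (h x z (inP _ xx) (inP _ zxy) xz).
have yy : x <= y <= y by rewrite lexx ltW.
rewrite ltrN2 lt_neqAle (h y x (inP _ yy) (inP _ xx) (ltW xy)) andbT; apply/eqP => e.
apply: (flat x y) => // z zxy; have /andP[xz zy] := zxy; apply/eqP; rewrite eq_le -{2}e.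
by rewrite (h z x (inP _ zxy) (inP _ xx) xz) (h y z (inP _ yy) (inP _ zxy) zy).
Qed.

Lemma piece_right u : 0 <= u < 1 -> exists2 i, (i < size s)%N & P i <= u < P i.+1.
Proof.
move=> /andP[u0]; rewrite -breakpoint_last.
elim: (size s) => [|n IH]; first by rewrite /P /=; lra.
case: (ltP u (P n)) => [/IH[i iN h] _|h1 h2]; first by exists i => //; exact: ltnW.
by exists n => //; rewrite h1.
Qed.

Lemma piece_left u : 0 < u <= 1 -> exists2 i, (i < size s)%N & P i < u <= P i.+1.
Proof.
move=> /andP[u0]; rewrite -breakpoint_last.
elim: (size s) => [|n IH]; first by rewrite /P /=; lra.
case: (leP u (P n)) => [/IH[i iN h] _|h1 h2]; first by exists i => //; exact: ltnW.
by exists n => //; rewrite h1.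
Qed.

Lemma strictly_monotone_between u v : 0 <= u -> u < v -> v <= 1 ->
  (forall c, c \in s -> u < c < v -> ~ local_extremum f c) -> strictly_monotone f u v.
Proof.
(* The bound 1 on [v] is generalized to a breakpoint [P n], for induction on the number of
   pieces. *)
rewrite -breakpoint_last; have := leqnn (size s); move: {-2}(size s) => n.
elim: n v => [|n IH] v nS u0 uv vn h; first by move: vn; rewrite /P /=; lra.
case: (leP v (P n)) => [vP|Pv]; first by apply: IH => //; exact: ltnW.
case: (leP (P n) u) => [Pu|uP].
  exact: (strictly_monotone_sub Pu vn (piece_strictly_monotone nS)).
have v1 : P n.+1 <= 1 by rewrite -breakpoint_last; apply: breakpoint_le.
have Ps : P n \in s.
  by move: uP nS; case: n {IH vn Pv v1} => [|n] uP nS; [move: uP; rewrite /P /=; lra|apply: mem_nth; exact: ltnW].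
apply: (@strictly_monotone_glue f u (P n) v) => //; first lra.
- by apply: h => //; rewrite uP.
- apply: (IH (P n) (ltnW nS) u0 uP (lexx _)) => c cs /andP[uc cn].
  by apply: h => //; rewrite uc (lt_trans cn).
- exact: (strictly_monotone_sub (lexx _) vn (piece_strictly_monotone nS)).
Qed.

Lemma extremum_unimodal c : local_extremum f c ->
  exists b u v, [/\ 0 <= u < c, c < v <= 1, increasing_on (fun x => sg b (f x)) u c &
    increasing_on (fun x => - sg b (f x)) c v].
Proof.
move=> ext; have [/andP[c0 c1] _] := ext.
have [|i iS /andP[h1 h2]] := @piece_left c; first by rewrite c0 ltW.
have [|j jS /andP[h3 h4]] := @piece_right c; first by rewrite c1 ltW.
have m1 := strictly_monotone_sub (lexx _) h2 (piece_strictly_monotone iS).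
have m2 := strictly_monotone_sub h3 (lexx _) (piece_strictly_monotone jS).
have [b [i1 i2]] := local_extremum_unimodal h1 h4 ext m1 m2.
exists b, (P i), (P j.+1); split => //.
  by rewrite h1 andbT (breakpoint_le (leq0n i) (ltnW iS)).
by rewrite h4 -breakpoint_last breakpoint_le.
Qed.

End Partition.
End MonotonePieces.

(** * Computability of the extrema *)

Section ComputableExtrema.
Variables (R : realType) (f : R -> R) (c : prog).
Hypothesis f_real : @realizes R unit_interval unit_interval c `[0, 1] f.

(** Semidecides whether [f], signed by [b], is larger at [q] than at [q']: a constant sequence is a
    name of its rational, and the threshold covers the errors of both values. *)
Definition val_gt (b : bool) (q q' t : nat) : bool :=
  has_lt t (fun j => [&& (0 < evalb c (fun=> q.+1) t j)%N, (0 < evalb c (fun=> q'.+1) t j)%N &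
    2^-1 ^+ j + 2^-1 ^+ j <
      (if b then clamp (ratn R (evalb c (fun=> q.+1) t j).-1)
                 - clamp (ratn R (evalb c (fun=> q'.+1) t j).-1)
       else clamp (ratn R (evalb c (fun=> q'.+1) t j).-1)
                 - clamp (ratn R (evalb c (fun=> q.+1) t j).-1))]).

Lemma cf_val_gt b Q Q' T : cfun Q -> cfun Q' -> cfun T ->
  cfun (fun p n => nat_of_bool (val_gt b (Q p n) (Q' p n) (T p n))).
Proof.
move=> cQ cQ' cT.
have pl F : cfun F -> cfun (fun p m => F p (cfst m)).
  by move=> cF; apply: (cf_comp cF (cf_fst cf_id)).
have := pl _ cQ => c1; have := pl _ cQ' => c2; have := pl _ cT => c3.
have := pl _ c1 => c4; have := pl _ c2 => c5.
by rewrite /val_gt; case: b; cbv iota; cf.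
Qed.

Lemma const_name q : 0 <= ratn R q <= 1 ->
  cauchy_name (@unit_interval R) (ratn R q) (fun=> q).
Proof.
move=> q01 k; change (`|ratn R q - clamp (ratn R q)| <= 2^-1 ^+ k).
by rewrite clamp_id // subrr normr0 ltW // half_gt0.
Qed.

Lemma f_eval q : 0 <= ratn R q <= 1 -> exists2 v : nat -> nat,
  (forall k, run (fun=> q) c k (v k)) & forall k, `|f (ratn R q) - clamp (ratn R (v k))| <= 2^-1 ^+ k.
Proof.
move=> q01; have [|_ /(_ _ (const_name q01))[v vrun vname]] := @f_real (ratn R q).
  by rewrite /= in_itv.
by exists v.
Qed.

Lemma eval_const q v t j : (forall k, run (fun=> q) c k (v k)) ->
  (0 < evalb c (fun=> q.+1) t j)%N -> (evalb c (fun=> q.+1) t j).-1 = v j.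
Proof.
move=> vrun; case E: (evalb c (fun=> q.+1) t j) => [|w] //= _.
by apply: (run_det _ (vrun j)); apply: (@evalb_sound _ (fun=> q.+1) c t j w _ E) => i w1 [].
Qed.

Lemma val_gt_sound b q q' t : 0 <= ratn R q <= 1 -> 0 <= ratn R q' <= 1 ->
  val_gt b q q' t -> sg b (f (ratn R q')) < sg b (f (ratn R q)).
Proof.
move=> q01 q'01 /has_ltP[j _ /and3P[h h']].
have [v vrun vname] := f_eval q01; have [v' vrun' vname'] := f_eval q'01.
rewrite (eval_const vrun h) (eval_const vrun' h').
by have := vname j; have := vname' j; rewrite /sg !ler_norml; case: b; lra.
Qed.

Lemma val_gt_complete b q q' : 0 <= ratn R q <= 1 -> 0 <= ratn R q' <= 1 ->
  sg b (f (ratn R q')) < sg b (f (ratn R q)) ->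
  exists B, forall t, (B <= t)%N -> val_gt b q q' t.
Proof.
move=> q01 q'01 lt.
have [v vrun vname] := f_eval q01; have [v' vrun' vname'] := f_eval q'01.
have [|j hj] := @half_lt_eps R ((sg b (f (ratn R q)) - sg b (f (ratn R q'))) / 4); first by lra.
have [B1 h1] := evalb_complete (vrun j); have [B2 h2] := evalb_complete (vrun' j).
exists (maxn j.+1 (maxn B1 B2)) => t; rewrite !geq_max => /and3P[jt t1 t2].
apply/has_ltP; exists j => //; rewrite h1 // h2 //=.
have := hj j (leqnn j); have := vname j; have := vname' j.
by rewrite /sg !ler_norml; case: b {lt hj}; lra.
Qed.

(* The extremum lies to the right of q as soon as some q' > q in the window has
   a larger value, and symmetrically; such q, q' exist arbitrarily close to it. *)
Lemma unimodal_computable b e u v : 0 <= u < e -> e < v <= 1 ->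
  increasing_on (fun x => sg b (f x)) u e ->
  increasing_on (fun x => - sg b (f x)) e v ->
  exists2 a, computable_seq a & forall k, `|e - ratn R (a k)| <= 2^-1 ^+ k.
Proof.
move=> /andP[u0 ue] /andP[ev v1] inc dec.
have [qa /andP[ua ae]] := ratn_between ue; have [qb /andP[eb bv]] := ratn_between ev.
(* [T] codes two ascents, from [q1] rightwards to [q1'] and from [q2] leftwards to [q2'], with the
   fuel [t] that confirms them. They enclose the extremum between [q1] and [q2], and [q1] is the
   output. *)
pose q1 T := cfst T; pose q1' T := cfst (csnd T); pose q2 T := cfst (csnd (csnd T)).
pose q2' T := cfst (csnd (csnd (csnd T))); pose t T := csnd (csnd (csnd (csnd T))).
pose P (n T : nat) := [&& ratn R qa <= ratn R (q1 T), ratn R (q1 T) < ratn R (q1' T),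
  ratn R (q1' T) <= ratn R qb, ratn R qa <= ratn R (q2' T), ratn R (q2' T) < ratn R (q2 T),
  ratn R (q2 T) <= ratn R qb, ratn R (q2 T) - ratn R (q1 T) <= 2^-1 ^+ n,
  val_gt b (q1' T) (q1 T) (t T) & val_gt b (q2' T) (q2 T) (t T)].
have cP : cfun (fun _ m => nat_of_bool (P (cfst m) (csnd m))).
  by rewrite /P /q1 /q2 /q1' /q2' /t; cf; apply: cf_val_gt; cf.
have cH : cfun2 (fun _ _ T => q1 T) by rewrite /q1 /cfun2; cf.
have ex n : exists T, P n T.
  have hn := half_gt0 R n.+1; pose d : R := 2^-1 ^+ n.+1.
  have [|x1 /andP[l1 r1]] := @ratn_between R (Num.max (ratn R qa) (e - d)) e.
    by rewrite gt_max ae /=; rewrite /d; lra.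
  have [x1' /andP[l1' r1']] := ratn_between r1.
  have [|x2 /andP[l2 r2]] := @ratn_between R e (Num.min (ratn R qb) (e + d)).
    by rewrite lt_min eb /=; rewrite /d; lra.
  have [x2' /andP[l2' r2']] := ratn_between l2.
  move: l1 r2; rewrite gt_max lt_min => /andP[l1 d1] /andP[r2 d2].
  have [|||B1 h1] := @val_gt_complete b x1' x1; [lra|lra| |].
    by apply: inc => //; lra.
  have [|||B2 h2] := @val_gt_complete b x2' x2; [lra|lra| |].
    by rewrite -ltrN2; apply: dec => //; lra.
  exists (cpair x1 (cpair x1' (cpair x2 (cpair x2' (maxn B1 B2))))).
  rewrite /P /q1 /q2 /q1' /q2' /t !(cfstK, csndK) h1 ?leq_maxl // h2 ?leq_maxr // !andbT.
  by have := half_expS R n; rewrite -/d => hd; do ![apply/andP; split]; lra.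
have [d hd] := @cfun_mu (fun _ => P) (fun _ _ T => q1 T) cP cH; have [|a ha aE] := hd (fun=> 0%N); first exact: ex.
exists a; first by exists d.
move=> k; have [T /and5P[h1 h2 h3 h4 /and5P[h5 h6 h7 g1 g2]] ->] := aE k.
have s1 : sg b (f (ratn R (q1 T))) < sg b (f (ratn R (q1' T))).
  by apply: val_gt_sound g1; lra.
have s2 : sg b (f (ratn R (q2 T))) < sg b (f (ratn R (q2' T))).
  by apply: val_gt_sound g2; lra.
have e1 : ratn R (q1 T) < e.
  rewrite ltNge; apply/negP => h.
  have := dec (ratn R (q1 T)) (ratn R (q1' T)) h h2 (ltW (le_lt_trans h3 bv)).
  by rewrite ltrN2 => /(lt_trans s1); rewrite ltxx.
have e2 : e < ratn R (q2 T).
  rewrite ltNge; apply/negP => h.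
  have := inc (ratn R (q2' T)) (ratn R (q2 T)) (ltW (lt_le_trans ua h4)) h5 h.
  by move=> /(lt_trans s2); rewrite ltxx.
by rewrite ler_norml; lra.
Qed.

End ComputableExtrema.

(** * Orbits and coordinates of the inverse limit *)

Section Orbits.
Variables (R : realType) (f : R -> R).

Lemma inverse_limit_iter (z : inverse_limit f) n k : carrier (inverse_limit f) z ->
  iter k f (z (n + k)%N) = z n.
Proof.
move=> [_ Kz]; elim: k n => [|k IH] n; first by rewrite addn0.
by rewrite iterSr addnS Kz IH.
Qed.

(** Earlier coordinates are iterates of later ones, so only those from [N] on matter. *)
Lemma inverse_limit_eq N (z z' : inverse_limit f) :
  carrier (inverse_limit f) z -> carrier (inverse_limit f) z' ->
  z N = z' N -> (forall n, z (N + n)%N = z' (N + n)%N -> z (N + n.+1)%N = z' (N + n.+1)%N) ->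
  z = z'.
Proof.
move=> Kz Kz' zN step; apply/funext => n.
have above k : z (N + k)%N = z' (N + k)%N by elim: k => [|k IH]; [rewrite addn0|exact: step].
rewrite -(inverse_limit_iter n N Kz) -(inverse_limit_iter n N Kz').
by rewrite addnC above.
Qed.

(** The orbit closure is a union of two forward orbits, hence countable and forward invariant. *)
Lemma eff_asymptotically_periodic_hull x : eff_asymptotically_periodic f x ->
  exists A : set R, [/\ pi01 unit_interval A, countable A,
    forall y k, A y -> A (iter k f y) & forall k, A (iter k f x)].
Proof.
move=> [pA [z [z01 _ AE]]]; exists (closure (forward_orbit f x)); split => //.
- have cO w : countable (forward_orbit f w).
    exact: sub_countable (card_image_le _ _) (countableP _).
  rewrite AE; have -> : forward_orbit f x `|` forward_orbit f z =
      \bigcup_(b in [set: bool]) (if b then forward_orbit f x else forward_orbit f z).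
    by apply/seteqP; split=> [y []|y [[] _]]; [exists true|exists false|left|right].
  by apply: bigcup_countable => // -[].
- rewrite AE => y k [[j _ <-]|[j _ <-]]; [left|right]; exists (k + j)%N => //; exact: iterD.
- by move=> k; rewrite AE; left; exists k.
Qed.

End Orbits.

(** * The two cases *)

(** Finitely many programs are merged into one. Past the end of [C] the value is 2, which no
    coordinate equals. *)
Lemma seq_approx (R : realType) (C : seq R) :
  (forall e, e \in C -> exists2 a, computable_seq a &
     forall k, `|e - ratn R (a k)| <= 2^-1 ^+ k) ->
  exists a : nat -> nat -> nat, cfun (fun _ n => a (cfst n) (csnd n)) /\
    forall i k, `|nth 2 C i - ratn R (a i k)| <= 2^-1 ^+ k.
Proof.
elim: C => [|e C IH] h.
  exists (fun _ _ => cpair 2 (cpair 0 0)); split; first by cf.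
  by move=> i k; rewrite ratn_frac divr1 nth_nil subrr normr0 ltW // half_gt0.
have [|a' [ca' ha']] := IH; first by move=> d dC; apply: h; rewrite in_cons dC orbT.
have [a /computable_seqP ca ha] := h e (mem_head _ _).
exists (fun i k => if i == 0%N then a k else a' i.-1 k); split; last by case.
cf; first exact: (cf_comp ca (cf_snd cf_id)).
by apply: (@cf2 (fun _ => a')); cf.
Qed.

Section Cases.
Variables (R : realType) (f : R -> R) (c : prog).
Hypothesis f_real : @realizes R unit_interval unit_interval c `[0, 1] f.

Let K := inverse_limit f.

Lemma tt_equiv_inside (A : set R) (x : K) : pi01 unit_interval A -> countable A ->
  carrier K x -> (forall n, A (x n)) ->
  exists2 y : @real_cantor R, carrier real_cantor y & tt_equiv K x real_cantor y.
Proof.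
move=> [u /computable_seqP cu AE] cA Kx Ax.
pose ctr j := clamp (ratn R (cfst (u j))).
pose rad j : R := (cfst (csnd (u j)))%:R / (csnd (csnd (u j))).+1%:R.
have AP y : 0 <= y <= 1 -> A y <-> forall j, ~ (ctr j - rad j < y < ctr j + rad j).
  have bE j : rational_ball unit_interval (u j) y <-> ctr j - rad j < y < ctr j + rad j.
    change (`|ctr j - y| < rad j <-> ctr j - rad j < y < ctr j + rad j).
    by rewrite ltr_norml; split; lra.
  rewrite AE => y01; split=> [[_ ny] j /bE jy|ny]; first by apply: ny; exists j.
  by split=> [|[j _ /bE]]; [rewrite /= in_itv|exact: ny].
have cctr F : cfun F -> crat (fun p n => ctr (F p n)).
  by move=> cF; rewrite /ctr; cf; apply: cf_comp cu cF.
have crad F : cfun F -> crat (fun p n => rad (F p n)).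
  by move=> cF; rewrite /rad; cf; apply: cf_comp cu cF.
(* [i] codes a ball of the complement of [A] together with a rational of [[0, 1]] inside it. *)
pose inb i := [&& 0 <= ratn R (csnd i), ratn R (csnd i) <= 1,
  ctr (cfst i) - rad (cfst i) < ratn R (csnd i) & ratn R (csnd i) < ctr (cfst i) + rad (cfst i)].
(* The default 2 lies outside [0, 1], so that it is never hit. *)
pose a i (k : nat) := if inb i then csnd i else cpair 2 (cpair 0 0).
pose r i := ratn R (a i 0%N).
(* Here [i] codes a coordinate and a ball, so that all coordinates are kept out of all balls, that
   is, in [A]. *)
pose lo i := ctr (csnd i) - rad (csnd i); pose hi i := ctr (csnd i) + rad (csnd i).
have DE (z : K) : avoiding cfst lo hi z -> carrier K z /\ forall n, A (z n).
  move=> [Kz h]; split => // n; apply/(AP _ (carrier01 Kz n)) => j.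
  by have := h (cpair n j); rewrite /lo /hi cfstK csndK.
have sepA (z : K) n i : avoiding cfst lo hi z -> z (1 + n)%N != r i.
  move=> /DE[Kz Az]; have z01 := carrier01 Kz (1 + n)%N; rewrite /r /a.
  case: ifP => [/and4P[_ _ h1 h2]|_].
    by apply/eqP => zE; apply: ((AP _ z01).1 (Az _) (cfst i)); rewrite zE h1.
  by rewrite ratn_frac divr1; apply/eqP => zE; move: z01; rewrite zE; lra.
have noLT (z z' : K) n : avoiding cfst lo hi z -> avoiding cfst lo hi z' ->
    address 0 r z = address 0 r z' -> ~ (z (1 + n)%N < z' (1 + n)%N).
  move=> /DE[Kz Az] /DE[Kz' Az'] [_ zz'] lt.
  (* [t] lies in a ball [j] of the complement; a rational [q] of this ball between [t] and the
     larger coordinate is one of the [r i] and separates the two points. *)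
  have [t [/andP[t1 t2] nAt]] := countable_avoid cA lt.
  have z01 := carrier01 Kz (1 + n)%N; have z01' := carrier01 Kz' (1 + n)%N.
  have [j tj] : exists j, ctr j - rad j < t < ctr j + rad j.
    apply: contrapT => h; apply/nAt/AP; first lra.
    by move=> j hj; apply: h; exists j.
  have [|q] := @ratn_between R t (Num.min (z' (1 + n)%N) (ctr j + rad j)).
    by rewrite lt_min t2 /=; lra.
  rewrite lt_min => /and3P[q1 q2 q3].
  have := congr1 (fun g => g (cpair n (cpair j q))) zz'.
  rewrite /= cfstK csndK /r /a /inb !(cfstK, csndK).
  have -> : [&& 0 <= ratn R q, ratn R q <= 1, ctr j - rad j < ratn R q & ratn R q < ctr j + rad j].
    by do ![apply/andP; split]; lra.
  by rewrite (lt_trans t1 q1) => /esym; rewrite ltNge (ltW q2).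
exists (address 0 r x : @real_cantor R) => //.
apply: (@address_tt_equiv R f c f_real 0 a r _ _ cfst lo hi) => //.
- rewrite /a /inb; cf; try apply: cctr; try apply: crad; cf.
- by move=> i k; rewrite /r subrr normr0 ltW // half_gt0.
- by cf.
- by rewrite /lo; cf; [apply: cctr|apply: crad]; cf.
- by rewrite /hi; cf; [apply: cctr|apply: crad]; cf.
- move=> z z' Dz Dz' zz'; have [Kz _] := DE z Dz; have [Kz' _] := DE z' Dz'.
  apply: (@inverse_limit_eq R f 0) => //; first by case: zz'.
  move=> n _; case: (ltgtP (z (0 + n.+1)%N) (z' (0 + n.+1)%N)) => // lt.
    by case: (noLT _ _ n Dz Dz' zz').
  by case: (noLT _ _ n Dz' Dz (esym zz')).
- split => // i; rewrite /lo /hi.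
  exact: ((AP _ (carrier01 Kx (cfst i))).1 (Ax _)).
Qed.

Lemma tt_equiv_outside (C : seq R) (N : nat) (x : K) :
  (forall e, e \in C -> exists2 a, computable_seq a &
     forall k, `|e - ratn R (a k)| <= 2^-1 ^+ k) ->
  (forall u v, 0 <= u -> u < v -> v <= 1 -> (forall e, e \in C -> ~ u < e < v) ->
     strictly_monotone f u v) ->
  carrier K x ->
  (forall e, e \in C -> exists A,
     [/\ pi01 unit_interval A, forall k, A (iter k f e) & ~ A (x N)]) ->
  exists2 y : @real_cantor R, carrier real_cantor y & tt_equiv K x real_cantor y.
Proof.
move=> /seq_approx[a [ca ha]] mono Kx hull.
(* For each extremum some ball around [x N] misses its hull; the finitely many margins have a
   positive minimum [d]. *)
have [d d0 dP] : exists2 d : R, 0 < d & forall e k, e \in C -> 0 <= iter k f e <= 1 ->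
    d <= `|iter k f e - x N|.
  elim: {ca ha mono a} C hull => [|e C IH] hull; first by exists 1.
  have [|d d0 dP] := IH; first by move=> e' e'C; apply: hull; rewrite in_cons e'C orbT.
  have [A [[u _ AE] Ae nAx]] := hull e (mem_head _ _).
  pose ctr j := clamp (ratn R (cfst (u j))).
  pose rad j : R := (cfst (csnd (u j)))%:R / (csnd (csnd (u j))).+1%:R.
  have [j xj] : exists j, `|ctr j - x N| < rad j.
    apply: contrapT => h; apply: nAx; rewrite AE; split.
      by rewrite /= in_itv; exact: (carrier01 Kx).
    by move=> [j _ hj]; apply: h; exists j.
  exists (Num.min d (rad j - `|ctr j - x N|)); first by rewrite lt_min d0 subr_gt0.
  move=> e' k; rewrite in_cons => /orP[/eqP-> _|e'C ek]; rewrite ge_min; last by rewrite dP.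
  apply/orP; right; have := Ae k; rewrite AE => -[_ nb].
  rewrite leNgt; apply/negP => lt; apply: nb; exists j => //.
  change (`|ctr j - iter k f e| < rad j).
  have := ler_normD (ctr j - x N) (x N - iter k f e); rewrite addrA subrK distrC.
  by rewrite (distrC (x N)) (distrC (ctr j)) in lt *; lra.
have [|l /andP[l1 l2]] := @ratn_between R (x N - d) (x N); first by lra.
have [|h /andP[h1 h2]] := @ratn_between R (x N) (x N + d); first by lra.
pose r i := nth 2 C i.
(* As coordinates lie in [[0, 1]], forbidding []-1, l[] and []h, 2[] confines [z N] to the rational
   interval [[l, h]], which lies within [d] of [x N]. *)
pose lo i : R := if i == 0%N then -1 else ratn R h.
pose hi i : R := if i == 0%N then ratn R l else 2.
pose idx (i : nat) := N.
have DE (z : K) : avoiding idx lo hi z -> carrier K z /\ ratn R l <= z N <= ratn R h.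
  move=> [Kz hz]; split => //; have := hz 0%N; have := hz 1%N; have := carrier01 Kz N.
  rewrite /lo /hi /idx /= => z01 n1 n0; apply/andP; split; rewrite leNgt; apply/negP => lt.
    by apply: n0; lra.
  by apply: n1; lra.
have noLT (z z' : K) n : avoiding idx lo hi z -> avoiding idx lo hi z' ->
    address N r z = address N r z' -> z (N + n)%N = z' (N + n)%N ->
    ~ (z (N + n.+1)%N < z' (N + n.+1)%N).
  move=> /DE[Kz _] /DE[Kz' _] [_ zz'] zn lt.
  (* Equal bits leave no extremum strictly between the two coordinates, so [f] is strictly monotone
     there and cannot send both to the same point. *)
  have [||||b hb] := mono (z (N + n.+1)%N) (z' (N + n.+1)%N) => //.
  - by have := carrier01 Kz (N + n.+1)%N; lra.
  - by have := carrier01 Kz' (N + n.+1)%N; lra.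
  - move=> e eC /andP[ze ez']; have := congr1 (fun g => g (cpair n (index e C))) zz'.
    rewrite /= cfstK csndK /r nth_index // addSnnS ze => /esym.
    by rewrite ltNge (ltW ez').
  have := hb _ _ (lexx _) lt (lexx _); rewrite addnS.
  by case: Kz => _ ->; case: Kz' => _ ->; rewrite zn ltxx.
exists (address N r x : @real_cantor R) => //.
apply: (@address_tt_equiv R f c f_real N a r ca ha idx lo hi) => //.
- by rewrite /idx; cf.
- by rewrite /lo; cf.
- by rewrite /hi; cf.
- move=> z n i /DE[Kz zlh]; rewrite /r; case: (ltnP i (size C)) => iC; last first.
    rewrite nth_default //; apply/eqP => zE.
    by have := carrier01 Kz (N.+1 + n)%N; rewrite zE; lra.
  (* If a later coordinate were an extremum, [z N] would lie on its orbit and yet within [d] of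
     [x N]. *)
  apply/eqP => zE; have := inverse_limit_iter N n.+1 Kz; rewrite -addSnnS zE => eN.
  have := dP _ n.+1 (mem_nth 2 iC); rewrite eN => /(_ (carrier01 Kz N)).
  by rewrite leNgt ltr_norml => /negP; apply; lra.
- move=> z z' Dz Dz' zz'; have [Kz _] := DE z Dz; have [Kz' _] := DE z' Dz'.
  apply: (@inverse_limit_eq R f N) => //; first by case: zz'.
  move=> n zn; case: (ltgtP (z (N + n.+1)%N) (z' (N + n.+1)%N)) => // lt.
    by case: (noLT _ _ n Dz Dz' zz' zn).
  by case: (noLT _ _ n Dz' Dz (esym zz') (esym zn)).
- split => // i; rewrite /lo /hi /idx; case: eqP => _; lra.
Qed.

End Cases.

Theorem theorem5p6 (R : realType) (f : R -> R)
    (f01 : forall x, 0 <= x <= 1 -> 0 <= f x <= 1)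
    (f_pm : piecewise_monotone f)
    (f_fin : finite_to_one f)
    (f_comp : computable_on unit_interval unit_interval `[0, 1] f)
    (f_ext : forall x, local_extremum f x -> eff_asymptotically_periodic f x)
    (x : inverse_limit f) (Kx : carrier (inverse_limit f) x) :
  exists2 y : real_cantor, carrier real_cantor y &
    tt_equiv (inverse_limit f) x real_cantor y.
Proof.
have [c f_real] := f_comp; have [s s_part s_mono] := f_pm.
pose C := [seq e <- s | `[< local_extremum f e >]].
have CP e : e \in C -> local_extremum f e by rewrite mem_filter => /andP[/asboolP].
(* The first case is taken for any countable Pi^0_1 set containing all coordinates; the orbit
   closures of the extrema are of this kind. *)
have [[A [pA cA Ax]]|none] := pselect (exists A : set R,
  [/\ pi01 unit_interval A, countable A & forall n, A (x n)]).
  exact: (tt_equiv_inside f_real pA cA Kx Ax).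
pose Q e N := exists A : set R, [/\ pi01 unit_interval A, forall y k, A y -> A (iter k f y),
  forall k, A (iter k f e) & ~ A (x N)].
have [||N hN] := @bounded_choice (size C) (fun i N => Q (nth 0 C i) N).
(* By forward invariance, coordinates after one outside [A] are outside too, so one [N] serves all
   extrema. *)
- move=> i N N' NN' [A [pA inv Ae nA]]; exists A; split => // AN'.
  apply: nA; have := inv _ (N' - N)%N AN'.
  by have := inverse_limit_iter N (N' - N) Kx; rewrite subnKC // => ->.
- move=> i iC; have [A [pA cA inv Ae]] := eff_asymptotically_periodic_hull (f_ext _ (CP _ (mem_nth 0 iC))).
  have [N nA] : exists N, ~ A (x N).
    by apply/existsNP => Ax; apply: none; exists A.
  by exists N, A.
apply: (@tt_equiv_outside R f c f_real C N) => //.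
- move=> e /CP ext; have [b [u [v [h1 h2 inc dec]]]] := extremum_unimodal f_fin s_part s_mono ext.
  exact: (unimodal_computable f_real h1 h2 inc dec).
- move=> u v u0 uv v1 noC; apply: (strictly_monotone_between f_fin s_part s_mono) => //.
  by move=> e es ev ext; apply: (noC e) => //; rewrite mem_filter es andbT; apply/asboolP.
- move=> e eC; have := hN (index e C); rewrite index_mem eC nth_index //.
  by move=> /(_ isT)[A [pA _ Ae nA]]; exists A.
Qed.
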